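(* Let $a,b\in\mathbb{R}$ be distinct, and let $T$ be a tree. The following statements characterize when $T$ admits no proper $\{a,b\}$-edge-weighting. (i) If $ab(a+b)\neq 0$, then $T$ admits no proper $\{a,b\}$-edge-weighting if and only if $T\cong K_2$. (ii) If $a+b=0$, then $T$ admits no proper $\{a,b\}$-edge-weighting if and only if $T\in\mathcal{C}$. (iii) If $ab=0$, then $T$ admits no proper $\{a,b\}$-edge-weighting if and only if both bipartition classes of $T$ have odd order and, for every component $H$ of the odd-cut skeleton $J(T)$, the tree $H$ belongs to $\mathcal{C}$ and the adjusted load $\lambda_T$ is constant on $V(H)$.
   Context: All graphs are finite and simple; the one-vertex tree is allowed as a tree (its bipartition classes have orders $1$ and $0$). The order of a graph or vertex set is its number of vertices. For a graph $G$, $E_G(v)$ is the set of edges incident with $v$ and $d_G(v)$ is the degree of $v$. For a set $W$ of real numbers, a $W$-edge-weighting of a graph $G$ is a map $\omega:E(G)\to W$. It induces the weighted degree $s_\omega(v)=\sum_{e\in E_G(v)}\omega(e)$ at each vertex $v$. The weighting is proper if $s_\omega(u)\neq s_\omega(v)$ for every edge $uv$ of $G$. For a graph $G$, $D_3(G)$ denotes the subgraph of $G$ induced by the vertices of degree $3$ in $G$. The empty graph is considered to have a perfect matching. $\mathcal{C}$ is the family of trees $H$ such that every vertex of $H$ has degree $1$ or $3$ in $H$ and $D_3(H)$ has a perfect matching (so $K_2\in\mathcal{C}$). For a tree $T$, the odd-cut skeleton $J(T)$ is the spanning forest of $T$ (with vertex set $V(T)$) whose edges are those edges $e$ of $T$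 for which both components of $T-e$ have odd order. A vertex incident with no such edge is an isolated vertex of $J(T)$. Suppose $T$ has bipartition $X\cup Y$ with $|X|$ and $|Y|$ odd. For every edge $e$ of $T$ not in $J(T)$ (a nonskeleton edge), the two components of $T-e$ have even order, and exactly one of them contains an odd number of vertices from each of $X$ and $Y$; orient $e$ toward that component (from its endpoint in the other component to its endpoint in that component). Let $\ell_T(v)$ be the number of nonskeleton edges incident with $v$ that are directed away from $v$. The adjusted load of $v$ is $\lambda_T(v)=d_{J(T)}(v)+2\ell_T(v)$. *)

(* Defs.v *)
From mathcomp Require Import all_boot all_algebra.
From mathcomp Require Import reals.

Set Implicit Arguments.
Unset Strict Implicit.
Unset Printing Implicit Defensive.

Import GRing.Theory.

(* The vertex set of a graph is the whole finite type V; subgraphs on fewer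
   vertices live on a subtype, see [induced]. *)
Record sgraph (V : finType) := SGraph {
  adj : rel V;
  adj_sym : symmetric adj;
  adj_irr : irreflexive adj
}.

Section Graphs.
Variables (V : finType) (G : sgraph V).
Implicit Types (S X Y : {set V}) (f : {set V}).

(* Edges are encoded as two-element vertex sets. *)
Definition edges : {set {set V}} :=
  [set f | [exists x, exists y, adj G x y && (f == [set x; y])]].

Definition edges_at (v : V) : {set {set V}} := [set f in edges | v \in f].

Definition degree (v : V) : nat := #|edges_at v|.

Definition component (v : V) : {set V} := [set u | connect (adj G) v u].

Definition components : {set {set V}} := [set component v | v : V].

Definition connected_graph : Prop :=
  0 < #|V| /\ forall u v : V, connect (adj G) u v.

(* A duplicate-free closed adjacency sequence of length 2 is just an edge
   walked back and forth; genuine cycles have length at least 3. *)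
Definition acyclic_graph : Prop :=
  forall c : seq V, ucycle (adj G) c -> size c <= 2.

Definition is_tree : Prop := connected_graph /\ acyclic_graph.

(* One of the classes may be empty, as for the one-vertex tree. *)
Definition bipartition X Y : Prop :=
  [/\ X :|: Y = [set: V], [disjoint X & Y] &
      forall u v, adj G u v -> (u \in X) && (v \in Y) || (u \in Y) && (v \in X)].

Definition perfect_matching (M : {set {set V}}) : Prop :=
  M \subset edges /\ forall v, #|[set f in M | v \in f]| = 1.

Definition has_perfect_matching : Prop := exists M, perfect_matching M.

Definition induced_adj S : rel {v : V | v \in S} :=
  [rel u v | adj G (val u) (val v)].

Lemma induced_adj_sym S : symmetric (@induced_adj S).
Proof. by move=> u v; rewrite /induced_adj /= adj_sym. Qed.

Lemma induced_adj_irr S : irreflexive (@induced_adj S).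
Proof. by move=> u; rewrite /induced_adj /= adj_irr. Qed.

Definition induced S : sgraph {v : V | v \in S} :=
  SGraph (@induced_adj_sym S) (@induced_adj_irr S).

Definition delete_edge_adj f : rel V :=
  [rel u v | adj G u v && ([set u; v] != f)].

Lemma delete_edge_adj_sym f : symmetric (delete_edge_adj f).
Proof. by move=> u v; rewrite /delete_edge_adj /= adj_sym setUC. Qed.

Lemma delete_edge_adj_irr f : irreflexive (delete_edge_adj f).
Proof. by move=> u; rewrite /delete_edge_adj /= adj_irr. Qed.

Definition delete_edge f : sgraph V :=
  SGraph (delete_edge_adj_sym f) (delete_edge_adj_irr f).

End Graphs.

Definition complete_adj n : rel 'I_n := [rel i j | i != j].

Lemma complete_adj_sym n : symmetric (@complete_adj n).
Proof. by move=> i j; rewrite /complete_adj /= eq_sym. Qed.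

Lemma complete_adj_irr n : irreflexive (@complete_adj n).
Proof. by move=> i; rewrite /complete_adj /= eqxx. Qed.

Definition complete_graph n : sgraph 'I_n :=
  SGraph (@complete_adj_sym n) (@complete_adj_irr n).

Definition isomorphic (V W : finType) (G : sgraph V) (H : sgraph W) : Prop :=
  exists2 h : V -> W, bijective h & forall u v, adj H (h u) (h v) = adj G u v.

Definition D3 (V : finType) (G : sgraph V) :
    sgraph {v : V | v \in [set v | degree G v == 3]} :=
  induced G [set v | degree G v == 3].

Definition familyC (V : finType) (H : sgraph V) : Prop :=
  [/\ is_tree H,
      forall v, degree H v = 1 \/ degree H v = 3 &
      has_perfect_matching (D3 H)].

Section Skeleton.
Variables (V : finType) (T : sgraph V).

Definition skeleton_adj : rel V :=
  [rel u v | adj T u v &&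
    [forall S in components (delete_edge T [set u; v]), odd #|S|]].

Lemma skeleton_adj_sym : symmetric skeleton_adj.
Proof. by move=> u v; rewrite /skeleton_adj /= adj_sym setUC. Qed.

Lemma skeleton_adj_irr : irreflexive skeleton_adj.
Proof. by move=> u; rewrite /skeleton_adj /= adj_irr. Qed.

Definition skeleton : sgraph V := SGraph skeleton_adj_sym skeleton_adj_irr.

(* The nonskeleton edge uv is oriented from u to v. *)
Definition directed (X Y : {set V}) (u v : V) : bool :=
  let S := component (delete_edge T [set u; v]) v in
  [&& adj T u v, ~~ adj skeleton u v, odd #|S :&: X| & odd #|S :&: Y|].

(* An edge leaving v is counted through its other endpoint. *)
Definition load (X Y : {set V}) (v : V) : nat :=
  #|[set u | directed X Y v u]|.

Definition adjusted_load (X Y : {set V}) (v : V) : nat :=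
  degree skeleton v + 2 * load X Y v.

End Skeleton.

Section Weightings.
Variables (R : realType) (V : finType) (G : sgraph V).
Local Open Scope ring_scope.

(* Only the values of w on the edges of G are relevant. *)
Definition edge_weighting (W : {pred R}) (w : {set V} -> R) : Prop :=
  forall f, f \in edges G -> w f \in W.

Definition weighted_degree (w : {set V} -> R) (v : V) : R :=
  \sum_(f in edges_at G v) w f.

Definition proper_weighting (w : {set V} -> R) : Prop :=
  forall u v, adj G u v -> weighted_degree w u != weighted_degree w v.

Definition admits_proper (W : {pred R}) : Prop :=
  exists w, edge_weighting W w /\ proper_weighting w.

End Weightings.

(* Main.v *)
Require Import Defs.
From mathcomp Require Import all_boot all_algebra.
From mathcomp Require Import boolp reals zify ring.

Set Implicit Arguments.
Unset Strict Implicit.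
Unset Printing Implicit Defensive.

Import GRing.Theory Num.Theory.

(* A weighting is propagated along the tree through the sets reach u v b of
   weighted degrees available at v when the edge uv has weight b and only the
   branch at v away from u has to be proper. T is colourable as soon as some
   vertex, or some edge, can combine such values without conflict.

   If ab(a + b) <> 0, every branch that is not a leaf has two values for each
   weight, which leaves enough room unless T is K2.

   In the other two cases, parity arguments show that an edge is either
   harmless or rigid (one value for each weight, of a controlled parity). If T
   is not colourable, a count of the conflicts at a vertex shows that it has
   one or three rigid edges, and in the latter case that exactly one of them
   has its two values further apart; these edges form the perfect matching.

   Conversely, given the matching, any weighting determines at every vertex v a
   neighbour F v whose edge explains the weighted degree of v. Some edge is
   swapped by F, and its endpoints have equal weighted degrees. *)

(** * Edges as two-element sets, and sums over neighbours *)

Section Neighbours.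
Variables (V : finType) (G : sgraph V).
Implicit Types (u v c : V).

Lemma adj_neq u v : adj G u v -> u != v.
Proof. by apply: contraTneq => ->; rewrite adj_irr. Qed.

Lemma set2_inj v : injective (fun c => [set v; c]).
Proof.
move=> c c' E; have := set22 v c; rewrite E !inE => /orP[]/eqP // cv.
by have := set22 v c'; rewrite -E cv !inE orbb => /eqP.
Qed.

Lemma set2_eq u v x y :
  ([set x; y] == [set u; v]) = (x == u) && (y == v) || (x == v) && (y == u).
Proof.
apply/eqP/idP => [E|/orP[]/andP[/eqP-> /eqP->] //]; last by rewrite setUC.
have := set21 x y; rewrite E !inE => /orP[]/eqP xE.
  by move: E; rewrite xE => /set2_inj ->; rewrite !eqxx.
by move: E; rewrite xE [RHS]setUC => /set2_inj ->; rewrite !eqxx orbT.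
Qed.

Lemma edges_atE v : edges_at G v = [set [set v; c] | c in [set c | adj G v c]].
Proof.
apply/setP => f; apply/idP/imsetP; rewrite !inE.
  case/andP => /existsP[x /existsP[y /andP[xy /eqP->]]].
  rewrite !inE => /orP[]/eqP ->; first by exists y; rewrite ?inE.
  by exists x; rewrite ?inE 1?adj_sym // setUC.
case=> c; rewrite inE => vc ->; rewrite set21 andbT.
by apply/existsP; exists v; apply/existsP; exists c; rewrite vc eqxx.
Qed.

Lemma degreeE v : degree G v = #|[set c | adj G v c]|.
Proof. by rewrite /degree edges_atE card_imset //; apply: set2_inj. Qed.

Lemma weighted_degreeE (R : realType) (w : {set V} -> R) v :
  weighted_degree G w v = (\sum_(c | adj G v c) w [set v; c])%R.
Proof.
rewrite /weighted_degree edges_atE big_imset /=; last by move=> ? ? _ _ /set2_inj.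
by apply: eq_bigl => c; rewrite inE.
Qed.

Lemma connect_propagate (P : pred V) x y :
  (forall p q, P p -> adj G p q -> P q) -> connect (adj G) x y -> P x -> P y.
Proof.
move=> clP /connectP[p]; elim: p x => [|z p IH] x /=; first by move=> _ ->.
by case/andP=> xz zp yE Px; apply: (IH z) => //; apply: clP xz.
Qed.

Lemma connect_adj_sym : connect_sym (adj G).
Proof. exact: sym_connect_sym (@adj_sym _ G). Qed.

End Neighbours.

(** * The two sides of a tree edge, and recursion over the branches at a vertex *)

Section Branches.
Variables (V : finType) (T : sgraph V).
Hypothesis treeT : is_tree T.
Implicit Types (u v c x y p q : V).

(** Indexed by an ordered pair: for an edge, [branch u v] and [branch v u] are its two sides. *)
Definition branch u v : {set V} := component (delete_edge T [set u; v]) v.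

Lemma branch_root u v : v \in branch u v.
Proof. by rewrite inE connect0. Qed.

Lemma branch_step u v x y : x \in branch u v -> adj T x y ->
  (x, y) != (u, v) -> (x, y) != (v, u) -> y \in branch u v.
Proof.
rewrite !inE => vx xy; rewrite !xpair_eqE => n1 n2.
apply: connect_trans vx (connect1 _).
by rewrite /= /delete_edge_adj /= xy set2_eq negb_or n1 n2.
Qed.

Lemma branch_ind u v (P : pred V) : P v ->
  (forall x y, x \in branch u v -> P x -> adj T x y ->
     (x, y) != (u, v) -> (x, y) != (v, u) -> P y) ->
  forall x, x \in branch u v -> P x.
Proof.
move=> Pv stepP x xB.
have: [pred z | (z \in branch u v) && P z] x.
  apply: (connect_propagate (G := delete_edge T [set u; v]) (x := v)).
  - move=> p q /andP[pB Pp] /andP[pq]; rewrite set2_eq negb_or => /andP[n1 n2].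
    rewrite -!xpair_eqE in n1 n2.
    by rewrite /= (branch_step pB) //=; apply: (stepP p).
  - by move: xB; rewrite inE.
  - by apply/andP; split; first exact: branch_root.
by case/andP.
Qed.

(** Otherwise a duplicate-free path from [v] to [u] avoiding the edge would close up to a cycle of
    length at least 3. *)
Lemma branch_parent u v : adj T u v -> u \notin branch u v.
Proof.
move=> uv; apply/negP; rewrite inE => /connectP[p pP uE].
case/shortenP: pP uE => q qP qU _ uE.
have qT : path (adj T) v q by apply: sub_path qP => x y /andP[].
have sz : size (v :: q) <= 2.
  by apply: treeT.2; rewrite /ucycle qU andbT /= rcons_path qT -uE.
case: q qP qU uE {qT} sz => [|z [|//]] /=.
  by move=> _ _ uE; rewrite uE adj_irr in uv.
by rewrite andbT => /andP[_ /eqP n1] _ uE _; case: n1; rewrite uE setUC.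
Qed.

Lemma branch_cover u v x : (x \in branch u v) || (x \in branch v u).
Proof.
apply: (connect_propagate (P := fun x => (x \in branch u v) || (x \in branch v u))
  _ (treeT.1.2 v x)); last by rewrite branch_root.
move=> p q + pq.
have [/eqP[-> ->]|n1] := boolP ((p, q) == (u, v)).
  by move=> _; rewrite branch_root.
have [/eqP[-> ->]|n2] := boolP ((p, q) == (v, u)).
  by move=> _; rewrite (branch_root v u) orbT.
by case/orP => pB; apply/orP; [left | right]; apply: (branch_step pB).
Qed.

Lemma branch_disj u v x : adj T u v -> x \in branch u v -> x \in branch v u -> False.
Proof.
move=> uv; rewrite !inE [in X in _ -> X -> _]setUC => vx ux.
have /negP[] := branch_parent uv; rewrite inE.
by apply: connect_trans vx _; rewrite connect_adj_sym.
Qed.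

Lemma branch_compl u v x : adj T u v -> (x \in branch v u) = (x \notin branch u v).
Proof.
move=> uv; apply/idP/negP; first by move=> xv xu; apply: branch_disj xu xv.
by move=> /negP xu; move: (branch_cover u v x); rewrite (negbTE xu).
Qed.

Lemma branch_sub u v c : adj T u v -> adj T v c -> c != u ->
  {subset branch v c <= branch u v}.
Proof.
move=> uv vc cu; apply: branch_ind.
  apply: (branch_step (branch_root u v)) => //; rewrite xpair_eqE negb_and.
    by rewrite eq_sym (adj_neq uv).
  by rewrite cu orbT.
move=> x y xB xu xy n1 n2; apply: branch_step xy _ _ => //.
  apply/eqP => -[xE yE]; subst x y; move: (xu); apply/negP; exact: branch_parent.
by apply/eqP => -[xE yE]; subst x; move: xB; apply/negP; apply: branch_parent.
Qed.

(** For [x] other than [v] this is the neighbour of [v] on the path to [x]; it sorts the remaining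
    vertices into the branches at [v]. In a tree the default [v] is met only at [x = v]. *)
Definition toward v x : V := odflt v [pick c | adj T v c && (x \in branch v c)].

Lemma toward_exists v x : x != v -> exists c, adj T v c && (x \in branch v c).
Proof.
move=> xv; apply/existsP.
have: (x == v) || [exists c, adj T v c && (x \in branch v c)].
  apply: (connect_propagate (P := fun x => (x == v) ||
     [exists c, adj T v c && (x \in branch v c)]) _ (treeT.1.2 v x)); last by rewrite eqxx.
  move=> p q /orP[/eqP -> vq|/existsP[c /andP[vc pc]] pq].
    by apply/orP; right; apply/existsP; exists q; rewrite vq branch_root.
  have [//|qv] := eqVneq q v.
  apply/orP; right; apply/existsP; exists c; rewrite vc.
  have [/eqP[_ ->]|n1] := boolP ((p, q) == (v, c)); first by rewrite branch_root.
  by rewrite (branch_step pc) // xpair_eqE (negbTE qv) andbF.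
by rewrite (negbTE xv).
Qed.

Lemma toward_adj v x : x != v -> adj T v (toward v x).
Proof.
move/toward_exists => [c cP]; rewrite /toward; case: pickP => [d /andP[]//|/(_ c)].
by rewrite cP.
Qed.

Lemma toward_mem v x : x != v -> x \in branch v (toward v x).
Proof.
move/toward_exists => [c cP]; rewrite /toward; case: pickP => [d /andP[]//|/(_ c)].
by rewrite cP.
Qed.

Lemma toward_eq v c x : adj T v c -> x \in branch v c -> toward v x = c.
Proof.
move=> vc xc.
have xv : x != v by apply: contraTneq xc => ->; apply: branch_parent.
have [//|tc] := eqVneq (toward v x) c.
have vt := toward_adj xv.
case: (branch_disj vc xc).
by apply: (@branch_sub c v (toward v x)) (toward_mem xv); rewrite // adj_sym.
Qed.

Lemma toward_self v c : adj T v c -> toward v c = c.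
Proof. by move=> vc; apply: toward_eq (branch_root _ _). Qed.

Lemma toward_step v p q : adj T p q -> p != v -> q != v -> toward v p = toward v q.
Proof.
move=> pq pv qv; apply/esym/toward_eq; first exact: toward_adj.
apply: branch_step (toward_mem pv) pq _ _; first by rewrite xpair_eqE (negbTE pv).
by rewrite xpair_eqE (negbTE qv) andbF.
Qed.

Lemma mem_branch u v x : adj T u v ->
  (x \in branch u v) = (x == v) || (toward v x != u).
Proof.
move=> uv; have vu : adj T v u by rewrite adj_sym.
have [->|xv] /= := eqVneq x v; first exact: branch_root.
apply/idP/idP => [xu|tu].
  apply: contraTneq xu => tu; rewrite (branch_compl _ vu) negbK -tu.
  exact: toward_mem.
by apply: (branch_sub uv (toward_adj xv) tu); apply: toward_mem.
Qed.

Lemma mem_branch_toward v c x : adj T v c ->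
  (x \in branch v c) = (x != v) && (toward v x == c).
Proof.
move=> vc; apply/idP/andP => [xc|[xv /eqP <-]]; last exact: toward_mem.
split; last by rewrite (toward_eq vc xc).
by apply: contraTneq xc => ->; apply: branch_parent.
Qed.

Lemma branch_card_lt u v c : adj T u v -> adj T v c -> c != u ->
  #|branch v c| < #|branch u v|.
Proof.
move=> uv vc cu; apply: proper_card; apply/properP; split.
  by apply/subsetP; apply: branch_sub.
by exists v; [exact: branch_root | exact: branch_parent].
Qed.

(* A self-map sending each vertex to a neighbour swaps two of them: follow it
   into ever smaller branches. *)
Lemma neighbour_map_swap (F : V -> V) : (forall v, adj T v (F v)) ->
  exists2 v, adj T v (F v) & F (F v) = v.
Proof.
move=> FP; have [v0] : exists v0 : V, true by case/card_gt0P: treeT.1.1 => v0; exists v0.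
move=> _; have [n] := ubnP #|branch v0 (F v0)|.
elim: n v0 => // n IH v leB; have [FF|nFF] := eqVneq (F (F v)) v; first by exists v.
apply: (IH (F v)); rewrite ltnS in leB.
exact: leq_trans (branch_card_lt (FP v) (FP (F v)) nFF) leB.
Qed.

(** Sorting the vertices by [toward v] splits the branch into its root and the branches one step
    further. *)
Lemma sum_branch (F : V -> nat) u v : adj T u v ->
  \sum_(x in branch u v) F x =
  F v + \sum_(c | adj T v c && (c != u)) \sum_(x in branch v c) F x.
Proof.
move=> uv; rewrite (bigD1 v) ?branch_root //=; congr (_ + _).
rewrite (partition_big (toward v) (fun c => adj T v c && (c != u))) /=; last first.
  by move=> x /andP[]; rewrite (mem_branch _ uv) => /orP[->//|->] xv; rewrite toward_adj.
apply: eq_bigr => c /andP[vc cu]; apply: eq_bigl => x.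
rewrite (mem_branch _ uv) (mem_branch_toward _ vc).
have [//|xv] /= := eqVneq x v; rewrite ?andbF // andbT.
by have [->|] := eqVneq (toward v x) c; rewrite ?cu ?andbF.
Qed.

Lemma sum_star (F : V -> nat) v :
  \sum_x F x = F v + \sum_(c | adj T v c) \sum_(x in branch v c) F x.
Proof.
rewrite (bigD1 v) //=; congr (_ + _).
rewrite (partition_big (toward v) (fun c => adj T v c)) /=; last exact: toward_adj.
by apply: eq_bigr => c vc; apply: eq_bigl => x; rewrite (mem_branch_toward _ vc).
Qed.

Lemma components_delete_edge u v : adj T u v ->
  components (delete_edge T [set u; v]) = [set branch u v; branch v u].
Proof.
move=> uv; have vuE : [set v; u] = [set u; v] by rewrite setUC.
have inB x y : x \in branch y x by apply: branch_root.
have compE x y : y \in component (delete_edge T [set u; v]) x ->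
    component (delete_edge T [set u; v]) y = component (delete_edge T [set u; v]) x.
  rewrite inE => xy; apply/setP => z; rewrite !inE.
  exact/esym/(same_connect (connect_adj_sym (delete_edge T [set u; v]))).
apply/setP => S; rewrite !inE; apply/imsetP/orP => [[x _ ->]|].
  have := branch_cover u v x; rewrite /branch vuE => /orP[/compE ->|/compE ->]; first by left.
  by right.
by case=> /eqP ->; [exists v | exists u]; rewrite // /branch vuE.
Qed.

Lemma skeletonE u v :
  adj (skeleton T) u v = [&& adj T u v, odd #|branch u v| & odd #|branch v u|].
Proof.
rewrite /= /skeleton_adj /=; case uv: (adj T u v) => //=.
rewrite components_delete_edge //; apply/forall_inP/andP => [oddB|[o1 o2] S].
  by split; apply: oddB; rewrite !inE eqxx ?orbT.
by rewrite !inE => /orP[]/eqP->.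
Qed.

Lemma directedE X Y u v :
  directed T X Y u v = [&& adj T u v, ~~ adj (skeleton T) u v,
    odd #|branch u v :&: X| & odd #|branch u v :&: Y|].
Proof. by []. Qed.

(* Distance parity from r, counting the arcs that separate x from r. *)
Lemma tree_two_colouring : exists col : V -> bool,
  forall u v, adj T u v -> col u = ~~ col v.
Proof.
have [r _] : exists r : V, true by case/card_gt0P: treeT.1.1 => r; exists r.
pose N x := [set e : V * V | [&& adj T e.1 e.2, x \in branch e.1 e.2
                               & r \notin branch e.1 e.2]].
have NE x p q :
    ((p, q) \in N x) = [&& adj T p q, x \in branch p q & r \notin branch p q].
  by rewrite in_set.
(* Only the arc [(u, v)] and its reverse tell [u] from [v], and the reverse has [r] on its far
   side. *)
have NS u v : adj T u v -> r \notin branch u v -> N v = (u, v) |: N u.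
  move=> uv ru; apply/setP => -[p q]; rewrite in_setU1 !NE.
  have [/eqP[-> ->]|n1] := boolP ((p, q) == (u, v)).
    by rewrite uv ru (branch_root u v).
  case pq: (adj T p q) => //=.
  have [/eqP[-> ->]|n2] := boolP ((p, q) == (v, u)).
    by rewrite (branch_compl r uv) ru !andbF.
  congr (_ && _); apply/idP/idP => xB; apply: (branch_step xB) => //.
  - by rewrite adj_sym.
  - by apply: contra n2 => /eqP[-> ->].
  - by apply: contra n1 => /eqP[-> ->].
  - by apply: contra n1 => /eqP[-> ->].
  - by apply: contra n2 => /eqP[-> ->].
exists (fun x => odd #|N x|).
have flip u v : adj T u v -> r \notin branch u v -> odd #|N u| = ~~ odd #|N v|.
  move=> uv ru; rewrite (NS u v uv ru) cardsU1 NE (negbTE (branch_parent uv)) andbF.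
  by rewrite oddD negbK.
move=> u v uv; have [ru|] := boolP (r \in branch u v); last exact: flip.
by rewrite (flip v u) ?negbK // 1?adj_sym // (branch_compl r uv) ru.
Qed.

End Branches.

(** * Two-valued weightings, and the values that a branch allows at its root *)

Section Colourings.
Variables (V : finType) (T : sgraph V) (M : zmodType) (wt : bool -> M).
Implicit Types (u v c p q : V) (w : V -> V -> bool).
Local Open Scope ring_scope.

(* Weightings with two values, read off on ordered pairs; only the values on
   adjacent pairs are relevant. *)
Definition symmetric_on_edges w := forall p q, adj T p q -> w p q = w q p.

Definition wsum w v : M := \sum_(c | adj T v c) wt (w v c).

Definition colourable : Prop :=
  exists2 w, symmetric_on_edges w & forall p q, adj T p q -> wsum w p != wsum w q.

(* The weighted degrees x that v can take in a weighting with value b on the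
   edge uv that is proper on the branch at v away from u. *)
Inductive reach : V -> V -> bool -> M -> Prop :=
  Reach u v (h : V -> bool) (y : V -> M) of
    (forall c, adj T v c -> c != u -> reach v c (h c) (y c)) &
    (forall c, adj T v c -> c != u -> y c != \sum_(d | adj T v d) wt (h d)) :
    reach u v (h u) (\sum_(d | adj T v d) wt (h d)).

Lemma reachI u v (h : V -> bool) :
  (forall c, adj T v c -> c != u ->
     exists2 y, reach v c (h c) y & y != \sum_(d | adj T v d) wt (h d)) ->
  reach u v (h u) (\sum_(d | adj T v d) wt (h d)).
Proof.
move=> H.
have /choice[y yP] : forall c, exists y, adj T v c -> c != u ->
    reach v c (h c) y /\ y != \sum_(d | adj T v d) wt (h d).
  move=> c; have [vc|] := boolP (adj T v c); last by exists 0.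
  have [->|cu] := eqVneq c u; first by exists 0.
  by have [y] := H c vc cu; exists y.
by apply: (Reach (y := y)) => c vc cu; have [] := yP c vc cu.
Qed.

Lemma reach_inv u v b x : reach u v b x -> exists h : V -> bool,
  [/\ h u = b, x = \sum_(d | adj T v d) wt (h d) &
      forall c, adj T v c -> c != u -> exists2 y, reach v c (h c) y & y != x].
Proof.
case=> {}u {}v h y H1 H2; exists h; split=> // c vc cu.
by exists (y c); [exact: H1 | exact: H2].
Qed.

Hypothesis treeT : is_tree T.

(** [P] marks the neighbours whose branches must be proper: all of them at a star, all but the
    parent when a branch is built. The weightings given on the branches agree with [h] at [v], hence
    glue. *)
Lemma star_glue v (P : pred V) (h : V -> bool) (y : V -> M) :
  (forall c, adj T v c -> P c -> exists w,
     [/\ symmetric_on_edges w, w v c = h c, wsum w c = y c &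
         forall p q, p \in branch T v c -> q \in branch T v c -> adj T p q ->
           wsum w p != wsum w q]) ->
  (forall c, adj T v c -> P c -> y c != \sum_(d | adj T v d) wt (h d)) ->
  exists w, [/\ symmetric_on_edges w, (forall c, adj T v c -> w v c = h c) &
    forall p q, (p == v) || P (toward T v p) -> (q == v) || P (toward T v q) ->
      adj T p q -> wsum w p != wsum w q].
Proof.
move=> H1 H2.
have /choice[w wP] : forall c, exists w, adj T v c ->
    [/\ symmetric_on_edges w, w v c = h c & P c ->
    wsum w c = y c /\ forall p q, p \in branch T v c -> q \in branch T v c ->
      adj T p q -> wsum w p != wsum w q].
  move=> c; have [vc|] := boolP (adj T v c); last by exists (fun _ _ => true).
  have [Pc|] := boolP (P c); last by exists (fun _ _ => h c).
  by have [w [w1 w2 w3 w4]] := H1 c vc Pc; exists w.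
(* A pair is read in the weighting of the branch at [v] that holds it, or that holds its endpoint
   other than [v]. *)
pose W p q := if p == v then w q p q else w (toward T v p) p q.
have WB p : p != v -> wsum W p = wsum (w (toward T v p)) p.
  by move=> pv; rewrite /wsum /W (negbTE pv).
have Wv : wsum W v = \sum_(d | adj T v d) wt (h d).
  by apply: eq_bigr => c vc; rewrite /W eqxx; have [_ -> _] := wP c vc.
have vstep q : adj T v q -> P (toward T v q) -> wsum W q != wsum W v.
  move=> vq; have qv : q != v by rewrite eq_sym; apply: adj_neq vq.
  rewrite WB // Wv toward_self // => Pq.
  by have [_ _ /(_ Pq)[-> _]] := wP q vq; exact: H2.
exists W; split.
- move=> p q pq; rewrite /W.
  have [pv|pv] := eqVneq p v; have [qv|qv] := eqVneq q v.
  + by rewrite pv qv.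
  + rewrite pv in pq *; rewrite toward_self //.
    by have [/(_ _ _ pq)-> _ _] := wP q pq.
  + rewrite qv adj_sym in pq *; rewrite toward_self //.
    by have [/(_ _ _ pq)-> _ _] := wP p pq.
  + rewrite (toward_step treeT pq pv qv).
    by have [/(_ _ _ pq)-> _ _] := wP _ (toward_adj treeT qv).
- by move=> c vc; rewrite /W eqxx; have [_ -> _] := wP c vc.
- move=> p q; have [->|pv] /= := eqVneq p v; have [->|qv] /= := eqVneq q v.
  + by rewrite adj_irr.
  + by move=> _ Pq vq; rewrite eq_sym vstep.
  + by move=> Pp _; rewrite adj_sym => vp; rewrite vstep.
  + move=> Pp _ pq; rewrite !WB // -(toward_step treeT pq pv qv).
    have [_ _ /(_ Pp)[_]] := wP _ (toward_adj treeT pv); apply => //.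
      exact: toward_mem.
    by rewrite (toward_step treeT pq pv qv); apply: toward_mem.
Qed.

(** Soundness of [reach]: by induction, the weightings of the smaller branches glue at [v]. *)
Lemma reach_weighting u v b x : reach u v b x -> adj T u v -> exists w,
  [/\ symmetric_on_edges w, w u v = b, wsum w v = x &
      forall p q, p \in branch T u v -> q \in branch T u v -> adj T p q ->
        wsum w p != wsum w q].
Proof.
elim=> {u v b x} u v h y _ IH H2 uv.
have vu : adj T v u by rewrite adj_sym.
have [w [w1 w2 w3]] := @star_glue v (predC1 u) h y
  (fun c vc cu => IH c vc cu vc) H2.
exists w; split=> //; first by rewrite w1 // w2.
  by apply: eq_bigr => c vc; rewrite w2.
by move=> p q; rewrite !mem_branch //; apply: w3.
Qed.

Lemma colourable_star v (h : V -> bool) :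
  (forall c, adj T v c ->
     exists2 y, reach v c (h c) y & y != \sum_(d | adj T v d) wt (h d)) ->
  colourable.
Proof.
move=> H.
have /choice[y yP] : forall c, exists y, adj T v c ->
    reach v c (h c) y /\ y != \sum_(d | adj T v d) wt (h d).
  move=> c; have [vc|] := boolP (adj T v c); last by exists 0.
  by have [y] := H c vc; exists y.
have [||w [w1 _ w3]] := @star_glue v predT h y.
- by move=> c vc _; have [r _] := yP c vc; apply: reach_weighting r vc.
- by move=> c vc _; have [] := yP c vc.
by exists w => // p q; apply: w3; rewrite orbT.
Qed.

(** The assignment [h] behind [x] already suits the other neighbours of [v]; its weight [b] on the
    edge to [u] lets [u] take the value [y]. *)
Lemma colourable_edge u v b x y :
  adj T u v -> reach u v b x -> reach v u b y -> x != y -> colourable.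
Proof.
move=> uv /reach_inv[h [hu xE H]] ry xy.
apply: (@colourable_star v h) => c vc; rewrite -xE.
have [->|cu] := eqVneq c u; last exact: H.
by exists y; [rewrite hu | rewrite eq_sym].
Qed.

End Colourings.

(** * Passing between real weights and two-valued weightings *)

Section ChangeOfWeights.
Variables (V : finType) (T : sgraph V).
Local Open Scope ring_scope.

(** Properness only compares sums, and an injective additive map preserves both sums and
    distinctness. *)
Lemma colourable_morph (M N : zmodType) (f : M -> N) (wt : bool -> M) :
  {morph f : x y / x + y} -> injective f ->
  colourable T (fun b => f (wt b)) <-> colourable T wt.
Proof.
move=> fD f_inj.
have f0 : f 0 = 0 by apply: (addIr (f 0)); rewrite -fD !add0r.
have fS w v : wsum T (fun b => f (wt b)) w v = f (wsum T wt w v).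
  by rewrite /wsum (big_morph f fD f0).
by split=> -[w w1 w2]; exists w => // p q /w2; rewrite !fS (inj_eq f_inj).
Qed.

(** Complementing the weighting exchanges the two values. *)
Lemma colourable_negb (M : zmodType) (wt : bool -> M) :
  colourable T (wt \o negb) -> colourable T wt.
Proof.
case=> w w1 w2; exists (fun p q => ~~ w p q) => [p q /w1-> //|]; exact: w2.
Qed.

Lemma admits_proper_colourable (R : realType) (a b : R) : a != b ->
  admits_proper T (pred2 a b) <-> colourable T (fun t => if t then a else b).
Proof.
move=> ab; split=> [[w [w1 w2]]|[w w1 w2]].
  exists (fun p q => w [set p; q] == a) => [p q _|]; first by rewrite setUC.
  move=> p q /w2; rewrite !weighted_degreeE.
  have E x : \sum_(c | adj T x c) w [set x; c] =
      wsum T (fun t => if t then a else b) (fun p q => w [set p; q] == a) x.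
    apply: eq_bigr => c xc.
    have /w1 : [set x; c] \in edges T.
      by rewrite inE; apply/existsP; exists x; apply/existsP; exists c; rewrite xc eqxx.
    by rewrite !inE; have [->|_ /eqP] := eqVneq.
  by rewrite !E.
(* [om] has to depend on the unordered edge only; by the symmetry of [w] either orientation gives
   the same answer. *)
pose om (f : {set V}) :=
  if [exists p, exists q, [&& adj T p q, f == [set p; q] & w p q]] then a else b.
have omE p q : adj T p q -> om [set p; q] = if w p q then a else b.
  move=> pq; rewrite /om; congr (if _ then _ else _); apply/existsP/idP.
    case=> p' /existsP[q' /and3P[pq']]; rewrite set2_eq.
    by case/orP=> /andP[/eqP-> /eqP->]; rewrite // w1.
  by move=> wpq; exists p; apply/existsP; exists q; rewrite pq eqxx.
exists om; split; first by move=> f _; rewrite /om !inE; case: ifP; rewrite eqxx ?orbT.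
have E x : weighted_degree T om x = wsum T (fun t => if t then a else b) w x.
  by rewrite weighted_degreeE; apply: eq_bigr => c; apply: omE.
by move=> p q pq; rewrite !E; apply: w2.
Qed.

End ChangeOfWeights.

(** * A counting argument for the conflicts at one vertex *)

Lemma subset_of_card (V : finType) (A B : {set V}) k :
  A \subset B -> #|A| <= k <= #|B| ->
  exists C : {set V}, [/\ A \subset C, C \subset B & #|C| = k].
Proof.
move=> AB; elim: k => [|k IH] /andP[Ak kB].
  by exists A; split=> //; apply/eqP; rewrite -leqn0.
have [Ek|nk] := eqVneq #|A| k.+1; first by exists A.
have [|C [AC CB Ck]] := IH; first by lia.
have /properP[_ [x xB xC]] : C \proper B by rewrite properEcard CB Ck.
exists (x |: C); split; last by rewrite cardsU1 xC Ck.
  by apply: subset_trans AC (subsetUr _ _).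
by rewrite subUset sub1set xB.
Qed.

(** Double counting: each element of [C] is counted for at most one [k]. *)
Lemma sum_card_unique (V : finType) (C : {set V}) (f : V -> nat -> bool) n :
  (forall c k l, c \in C -> f c k -> f c l -> k = l) ->
  \sum_(k < n) #|[set c in C | f c k]| <= #|C|.
Proof.
move=> f1; under eq_bigr do rewrite -sum1dep_card.
rewrite (exchange_big_dep (mem C)) /=; last by move=> k c _ /andP[].
rewrite -sum1_card; apply: leq_sum => c cC.
rewrite sum1dep_card; case: (set_0Vmem [set k : 'I_n | c \in C & f c k]) => [->|[k]].
  by rewrite cards0.
rewrite inE => /andP[_ fk]; rewrite -(cards1 k); apply: subset_leq_card.
by apply/subsetP => l; rewrite !inE => /andP[_ fl]; apply/eqP/val_inj; apply: f1 fl fk.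
Qed.

Section LocalLemma.
Variables (V : finType) (C : {set V}) (f0 f1 : V -> nat -> bool).
Hypothesis f0_unique : forall c k l, c \in C -> f0 c k -> f0 c l -> k = l.
Hypothesis f1_unique : forall c k l, c \in C -> f1 c k -> f1 c l -> k = l.
Hypothesis f01_odd : forall c k l, c \in C -> f0 c k -> f1 c l -> odd (k + l).
(* If k of the edges to C carry a 1, then a 0 (a 1) on the edge to c is
   forbidden when f0 c k (when f1 c k). *)
Hypothesis stuck : forall A : {set V}, A \subset C ->
  exists2 c, c \in C & if c \in A then f1 c #|A| else f0 c #|A|.

Let n0 k := #|[set c in C | f0 c k]|.
Let n1 k := #|[set c in C | f1 c k]|.

(** If both counts were small, some [A] of size [k] would contain every [c] with [f0 c k] and no [c]
    with [f1 c k], contradicting [stuck]. Parity makes these two sets disjoint. *)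
Lemma stuck_count k : k <= #|C| -> (k < n0 k) || (#|C| - k < n1 k).
Proof.
move=> kC; apply: contraT; rewrite negb_or -!leqNgt => /andP[l0 l1].
have [||A [A0 A1 Ak]] :=
    @subset_of_card V [set c in C | f0 c k] [set c in C | ~~ f1 c k] k.
- apply/subsetP => c; rewrite !inE => /andP[cC f0k]; rewrite cC /=.
  by apply/negP => /(f01_odd cC f0k); rewrite addnn odd_double.
- rewrite l0 /=; have := cardsID [set c | f1 c k] C.
  have -> : C :&: [set c | f1 c k] = [set c in C | f1 c k] by apply/setP => c; rewrite !inE.
  have -> : C :\: [set c | f1 c k] = [set c in C | ~~ f1 c k].
    by apply/setP => c; rewrite !inE andbC.
  by move: l1; rewrite /n1; lia.
have [|c cC] := stuck (A := A).
  by apply: subset_trans A1 _; apply/subsetP => c; rewrite inE => /andP[].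
rewrite Ak; case: ifPn => [cA f1c|/negP cA f0c].
  by have := subsetP A1 c cA; rewrite inE f1c andbF.
by case: cA; apply: (subsetP A0); rewrite inE cC.
Qed.

(** For [#|C| > 3], summing [stuck_count] over all [k] up to [#|C|] gives at least [3 * (#|C| - 1)],
    whereas uniqueness bounds the total by [2 * #|C|]. *)
Lemma stuck_size : #|C| <= 3.
Proof.
rewrite leqNgt; apply/negP => C3.
have := sum_card_unique #|C|.+1 f0_unique; have := sum_card_unique #|C|.+1 f1_unique.
rewrite -/n0 -/n1; move: stuck_count; move: #|C| C3 => [|[|[|[|d]]]] // _ S.
have: \sum_(k < d.+4.+1) minn k.+1 (d.+4 - k).+1 <= \sum_(k < d.+4.+1) (n0 k + n1 k).
  by apply: leq_sum => k _; have := S k; have := ltn_ord k; lia.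
have: \sum_(2 <= k < d.+3) 3 <= \sum_(2 <= k < d.+3) minn k.+1 (d.+4 - k).+1.
  by rewrite big_nat [X in _ <= X]big_nat; apply: leq_sum => k; lia.
rewrite sum_nat_const_nat big_split /=.
rewrite -(big_mkord xpredT (fun k => minn k.+1 (d.+4 - k).+1)).
rewrite [X in _ -> X <= _ -> _]big_ltn // [X in _ -> _ + X <= _ -> _]big_ltn //.
rewrite [X in _ -> _ + (_ + X) <= _ -> _]big_nat_recr //=.
rewrite [X in _ -> _ + (_ + (X + _)) <= _ -> _]big_nat_recr //=.
by set x := \sum_(_ <= _ < _) _; set y := \sum_(_ < _) _; set z := \sum_(_ < _) _; lia.
Qed.

(** Sizes 0 and 2 contradict the counts. For size 3 they force [n0 0 = 1], [n0 1 = 2], [n1 2 = 2]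
    and [n1 3 = 1], and parity pairs 0 with 3 and 1 with 2. *)
Lemma stuck_structure :
  [/\ #|C| = 1 \/ #|C| = 3,
      forall c, c \in C -> (f0 c 0 /\ f1 c #|C|) \/ [/\ #|C| = 3, f0 c 1 & f1 c 2] &
      #|[set c in C | f1 c 3]| = (#|C| == 3)].
Proof.
have B0 : n0 0 + n0 1 + n0 2 + n0 3 <= #|C|.
  have := sum_card_unique 4 f0_unique.
  by rewrite !big_ord_recl big_ord0 addn0 !addnA.
have B1 : n1 0 + n1 1 + n1 2 + n1 3 <= #|C|.
  have := sum_card_unique 4 f1_unique.
  by rewrite !big_ord_recl big_ord0 addn0 !addnA.
have := stuck_count; have := stuck_size; rewrite -/(n1 3).
case dE: #|C| B0 B1 => [|[|[|[|//]]]] B0 B1 _ S.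
- by exfalso; have := S 0 isT; lia.
- have S0 := S 0 isT; have S1 := S 1 isT.
  have full (f : V -> nat -> bool) k : 0 < #|[set c in C | f c k]| ->
      forall c, c \in C -> f c k.
    move=> fk c cC; have /eqP CE : [set c in C | f c k] == C.
      by rewrite eqEcard dE fk andbT; apply/subsetP => x; rewrite inE => /andP[].
    by move: cC; rewrite -{1}CE inE => /andP[].
  split; [by left| |by lia] => c cC; left.
  by split; apply: (full) => //; rewrite -/(n0 0) -/(n1 1); lia.
- by exfalso; have S0 := S 0 isT; have S1 := S 1 isT; have S2 := S 2 isT; lia.
- have S0 := S 0 isT; have S1 := S 1 isT; have S2 := S 2 isT; have S3 := S 3 isT.
  (* Two disjoint subsets of total size 3 cover [C]. *)
  have full (f : V -> nat -> bool) k l : k != l ->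
      (forall c k l, c \in C -> f c k -> f c l -> k = l) ->
      3 <= #|[set c in C | f c k]| + #|[set c in C | f c l]| ->
      forall c, c \in C -> f c k || f c l.
    move=> kl fu fk c cC.
    have /eqP CE : [set c in C | f c k || f c l] == C.
      rewrite eqEcard dE; apply/andP; split.
        by apply/subsetP => x; rewrite inE => /andP[].
      apply: leq_trans fk _; rewrite -cardsUI.
      have -> : [set c in C | f c k] :&: [set c in C | f c l] = set0.
        apply/setP => x; rewrite !inE; apply/negP => /and3P[/andP[xC fk] _ fl].
        by move: kl; rewrite (fu x k l xC fk fl) eqxx.
      rewrite cards0 addn0; apply: subset_leq_card; apply/subsetP => x.
      by rewrite !inE -andb_orr.
    by move: cC; rewrite -{1}CE inE => /andP[].
  split; [by right| |by lia] => c cC.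
  have /orP F0 := full f0 0 1 isT f0_unique (ltac:(rewrite -/(n0 0) -/(n0 1); lia)) c cC.
  have /orP F1 := full f1 3 2 isT f1_unique (ltac:(rewrite -/(n1 3) -/(n1 2); lia)) c cC.
  case: F0 F1 => f0c [] f1c; [by left | | | by right].
    by have := f01_odd cC f0c f1c.
  by have := f01_odd cC f0c f1c.
Qed.

End LocalLemma.

(** * Trees without a vertex of degree above 1 *)

Section K2.
Variables (V : finType) (T : sgraph V).

(** Both endpoints see only their common edge, so their weighted degrees agree. *)
Lemma K2_not_colourable (M : zmodType) (wt : bool -> M) :
  isomorphic T (complete_graph 2) -> ~ colourable T wt.
Proof.
case=> h h_bij hP [w w1 w2].
have ord2 (i j k : 'I_2) : i != j -> i != k -> j = k.
  rewrite -!val_eqE => ij ik; apply/val_inj.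
  by move: ij ik (ltn_ord i) (ltn_ord j) (ltn_ord k); rewrite /=; lia.
have one x y : adj T x y -> wsum T wt w x = wt (w x y).
  rewrite -hP /= => xy; apply: big_pred1 => z; rewrite -hP /= /complete_adj /=.
  apply/idP/eqP => [xz|-> //].
  by apply: (bij_inj h_bij); apply: (ord2 (h x)).
have [u hu] : exists u, h u = ord0 by case: h_bij => g _ gK; exists (g ord0); rewrite gK.
have [v hv] : exists v, h v = ord_max by case: h_bij => g _ gK; exists (g ord_max); rewrite gK.
have uv : adj T u v by rewrite -hP hu hv.
have := w2 u v uv; rewrite (one u v uv) (one v u); last by rewrite adj_sym.
by rewrite w1 // eqxx.
Qed.

Hypothesis treeT : is_tree T.

(** Without a vertex of degree above 1 the tree is a single edge or a single vertex; the latter is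
    colourable vacuously. *)
Lemma K2_or_branching (M : zmodType) (wt : bool -> M) :
  [\/ isomorphic T (complete_graph 2), colourable T wt | exists v, 1 < degree T v].
Proof.
have [/existsP[v dv]|/existsPn d1] := boolP [exists v, 1 < degree T v].
  by constructor 3; exists v.
have [/existsP[u /existsP[v uv]]|/existsPn noedge] :=
    boolP [exists u, exists v, adj T u v]; last first.
  constructor 2; exists (fun _ _ => true) => // p q pq.
  by have /existsPn/(_ q)/negP := noedge p.
constructor 1.
have nb x y z : adj T x y -> adj T x z -> y = z.
  move=> xy xz; have := d1 x; rewrite -leqNgt degreeE => /card_le1_eqP; apply;
    by rewrite inE.
have all2 x : (x == u) || (x == v).
  apply: (connect_propagate (P := fun x => (x == u) || (x == v)) _ (treeT.1.2 u x));
    last by rewrite eqxx.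
  move=> p q /orP[]/eqP -> pq; first by rewrite (nb _ _ _ pq uv) eqxx orbT.
  by rewrite adj_sym in uv; rewrite (nb _ _ _ pq uv) eqxx.
have nuv := adj_neq uv.
exists (fun x => if x == u then ord0 else ord_max : 'I_2).
  exists (fun i => if i == ord0 then u else v) => x /=.
    by have [->|xu] := eqVneq x u; [|have := all2 x; rewrite (negbTE xu) => /eqP ->].
  have [->|x0] := eqVneq x ord0; first by rewrite eqxx.
  rewrite eq_sym (negbTE nuv); apply/val_inj => /=.
  by move: x0 (ltn_ord x); rewrite -val_eqE /=; lia.
have vu : adj T v u by rewrite adj_sym.
move=> x y; rewrite /= /complete_adj /=.
by case/orP: (all2 x) => /eqP ->; case/orP: (all2 y) => /eqP ->;
   rewrite ?eqxx ?(eq_sym v u) ?(negbTE nuv) ?adj_irr ?uv ?vu.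
Qed.

End K2.

(** * Distinct nonzero weights with nonzero sum *)

Section GenericWeights.
Variables (R : numDomainType) (V : finType) (T : sgraph V) (wt : bool -> R).
Local Open Scope ring_scope.
Hypothesis treeT : is_tree T.
Hypothesis wt_neq0 : forall t, wt t != 0.
Hypothesis wt_neq : wt true != wt false.
Hypothesis wt_add : wt true + wt false != 0.
Implicit Types (u v c : V) (t : bool).

Lemma wt_neqb t : wt t != wt (~~ t).
Proof. by case: t => //=; rewrite eq_sym. Qed.

Lemma wt_addb t : wt t + wt (~~ t) != 0.
Proof. by case: t => //=; rewrite addrC. Qed.

Lemma wt_sumE v t (A : {set V}) : A \subset [set c | adj T v c] ->
  \sum_(c | adj T v c) wt (if c \in A then t else ~~ t) =
  wt (~~ t) *+ degree T v + (wt t - wt (~~ t)) *+ #|A|.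
Proof.
move=> sA.
rewrite (eq_bigr (fun c => wt (~~ t) + (if c \in A then wt t - wt (~~ t) else 0))).
  rewrite big_split /= sumr_const -big_mkcondr /= degreeE cardsE; congr (_ + _).
  rewrite -sumr_const; apply: eq_bigl => c; have [cA|] := boolP (c \in A).
    by have := subsetP sA c cA; rewrite inE => ->.
  by rewrite andbF.
by move=> c _; case: ifP => _; rewrite ?addr0 // addrC subrK.
Qed.

Lemma leaf_reach u v t : adj T u v -> (forall c, adj T v c -> c = u) ->
  reach T wt u v t (wt t).
Proof.
move=> uv leaf; have -> : wt t = \sum_(c | adj T v c) wt t.
  rewrite (big_pred1 u) // => c; apply/idP/eqP => [/leaf //|->].
  by rewrite adj_sym.
have := @reachI V T R wt u v (fun _ => t); apply=> c vc.
by rewrite (leaf c vc) eqxx.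
Qed.

(* With d = degree T v and k edges of weight wt t at v, leaves block k = 1 only
   if wt t + (d - 2) wt (~~ t) = 0; then d > 3 and k = 3 is not blocked. *)
Lemma two_values u v t : adj T u v -> (1 < degree T v)%N ->
  exists x y, [/\ x != y, reach T wt u v t x & reach T wt u v t y].
Proof.
have [n] := ubnP #|branch T u v|; elim: n u v t => // n IH u v t + uv dv.
rewrite ltnS => ltB; have vu : adj T v u by rewrite adj_sym.
set p := wt t; set q := wt (~~ t); set d := degree T v.
have pq : p != q := wt_neqb t.
(* With [k] edges of weight [p] at [v], [uv] among them, a leaf other than [u] can have the value
   [p] only if [k > 1] and the value [q] only if [k < d]; larger branches always have a second
   value. *)
have xk k : (0 < k <= d)%N -> ((1 < k)%N -> q *+ d + (p - q) *+ k != p) ->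
    ((k < d)%N -> q *+ d + (p - q) *+ k != q) -> reach T wt u v t (q *+ d + (p - q) *+ k).
  move=> /andP[k0 kd] kp kq.
  have [||A [uA sA Ak]] := @subset_of_card V [set u] [set c | adj T v c] k.
  - by rewrite sub1set inE.
  - by rewrite cards1 k0 -degreeE.
  rewrite -Ak -(wt_sumE t sA).
  have hu : (if u \in A then t else ~~ t) = t by rewrite -sub1set uA.
  rewrite -{1}hu; apply: (reachI (h := fun c => if c \in A then t else ~~ t)) => c vc cu.
  rewrite (wt_sumE t sA) Ak -/p -/q -/d.
  have [dc|dc] := ltnP 1 (degree T c).
    have [|//|//|x [y [xy rx ry]]] := IH v c (if c \in A then t else ~~ t).
      by apply: leq_trans (branch_card_lt treeT uv vc cu) ltB.
    have [xE|nx] := eqVneq x (q *+ d + (p - q) *+ k); last by exists x.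
    by exists y; rewrite // -xE eq_sym.
  exists (wt (if c \in A then t else ~~ t)).
    apply: leaf_reach => // e ce; move: dc; rewrite degreeE => /card_le1_eqP; apply;
      by rewrite inE // adj_sym.
  rewrite eq_sym; case: ifP => cA.
    apply: kp; rewrite -Ak (cardsD1 u) -sub1set uA add1n ltnS card_gt0.
    by apply/set0Pn; exists c; rewrite !inE cu.
  apply: kq; rewrite -Ak /d degreeE; apply: proper_card; apply/properP; split=> //.
  by exists c; rewrite ?inE ?cA.
have inj k l : (k != l)%N -> q *+ d + (p - q) *+ k != q *+ d + (p - q) *+ l.
  have pq0 : p - q != 0 by rewrite subr_eq0.
  by move=> kl; rewrite (inj_eq (addrI _)) (inj_eq (mulrIn pq0)).
have full : q *+ d + (p - q) *+ d != p.
  rewrite -mulrnDl addrC subrK -[X in _ != X]mulr1n.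
  by rewrite (inj_eq (mulrIn (wt_neq0 t))); lia.
have [d2 dE] : exists d2 : nat, d = d2.+2 by exists d.-2; lia.
have E k : (q *+ d + (p - q) *+ k.+1 == q) = (p + q *+ d2 + (p - q) *+ k == 0).
  rewrite dE -subr_eq0; congr (_ == _); rewrite !mulrS; ring.
have [bad|ok] := eqVneq (p + q *+ d2) 0; last first.
  exists (q *+ d + (p - q) *+ 1), (q *+ d + (p - q) *+ d); split.
  - by apply: inj; lia.
  - by apply: xk => //; [lia | rewrite E mulr0n addr0].
  - by apply: xk => //; lia.
(* Under [bad], degree 2 would mean [p = 0] and degree 3 would mean [p + q = 0]. *)
have d3 : (2 < d)%N.
  rewrite ltnNge; apply/negP => dle.
  have d20 : d2 = 0%N by lia.
  by have := wt_neq0 t; rewrite -/p; move: bad; rewrite d20 mulr0n addr0 => ->; rewrite eqxx.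
have d4 : (3 < d)%N.
  rewrite ltnNge; apply/negP => dle.
  have d21 : d2 = 1%N by lia.
  by have := wt_addb t; rewrite -/p -/q; move: bad; rewrite d21 mulr1n => ->; rewrite eqxx.
exists (q *+ d + (p - q) *+ 3), (q *+ d + (p - q) *+ d); split.
- by apply: inj; lia.
(* By [bad], [q *+ d2] is [- p]; the resulting value is at distance [p - q] from [p] and twice that
   from [q]. *)
- have x3 : q *+ d + (p - q) *+ 3 = p + p - q.
    apply/eqP; rewrite -subr_eq0; apply/eqP; rewrite -[RHS]bad dE !mulrS; ring.
  apply: xk; rewrite ?x3; first by lia.
    by move=> _; rewrite -subr_eq0 (_ : _ - p = p - q) ?subr_eq0 //; ring.
  move=> _; rewrite -subr_eq0 (_ : _ - q = (p - q) *+ 2); last by ring.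
  by rewrite mulrn_eq0 /= subr_eq0.
- by apply: xk => //; lia.
Qed.

(** Weight [wt true] on all edges at [v] gives [wt true *+ degree T v], which differs from the value
    [wt true] of a leaf; the other neighbours have a second value. *)
Lemma generic_colourable v : (1 < degree T v)%N -> colourable T wt.
Proof.
move=> dv; apply: (colourable_star treeT (v := v) (h := fun=> true)) => c vc.
rewrite sumr_const -(cardsE (adj T v)) -degreeE.
have [dc|dc] := ltnP 1 (degree T c).
  have [x [y [xy rx ry]]] := two_values true vc dc.
  have [xE|nx] := eqVneq x (wt true *+ degree T v); last by exists x.
  by exists y; rewrite // -xE eq_sym.
exists (wt true).
  apply: leaf_reach => // e ce; move: dc; rewrite degreeE => /card_le1_eqP; apply;
    by rewrite inE // adj_sym.
rewrite -[X in X != _]mulr1n.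
by rewrite (inj_eq (mulrIn (wt_neq0 true))); lia.
Qed.

End GenericWeights.

(** * The family C through a matching relation on vertices *)

Section TripleMatching.
Variables (V : finType) (G : sgraph V).

(** The degree and matching conditions of [familyC], with the matching of [D3] kept on [V] itself
    rather than on a subtype. *)
Definition triple_matching (m : rel V) : Prop :=
  [/\ symmetric m, (forall u v, m u v -> adj G u v),
      forall v, degree G v = 1 \/ degree G v = 3 &
      forall v, #|[set c | m v c]| = (degree G v == 3)].

Lemma card_sub_val (S : {set V}) (P : pred V) : (forall c, P c -> c \in S) ->
  #|[set b : {v | v \in S} | P (val b)]| = #|[set c | P c]|.
Proof.
move=> PS; rewrite -(card_imset _ val_inj); apply: eq_card => c; rewrite [RHS]inE.
apply/imsetP/idP => [[b]|Pc]; first by rewrite inE => Pb ->.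
by exists (Sub c (PS c Pc)); rewrite ?inE SubK.
Qed.

Lemma matched_edgesE (M : {set {set V}}) v : M \subset edges G ->
  [set f in M | v \in f] = [set [set v; c] | c in [set c | [set v; c] \in M]].
Proof.
move=> sM; apply/setP => f; apply/idP/imsetP; rewrite inE; last first.
  by case=> c; rewrite inE => cM ->; rewrite cM set21.
case/andP => fM vf; have : f \in edges_at G v by rewrite inE (subsetP sM f fM).
by rewrite edges_atE => /imsetP[c _ fE]; exists c; rewrite // inE -fE.
Qed.

Lemma card_matched_edges (M : {set {set V}}) v : M \subset edges G ->
  #|[set f in M | v \in f]| = #|[set c | [set v; c] \in M]|.
Proof. by move=> sM; rewrite matched_edgesE // card_imset //; apply: set2_inj. Qed.

Lemma mem_edges u v : ([set u; v] \in edges G) = adj G u v.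
Proof.
rewrite inE; apply/existsP/idP => [[x /existsP[y /andP[xy]]]|uv].
  by rewrite set2_eq => /orP[]/andP[/eqP-> /eqP->] //; rewrite adj_sym.
by exists u; apply/existsP; exists v; rewrite uv eqxx.
Qed.

End TripleMatching.

Lemma familyC_triple_matching (V : finType) (G : sgraph V) :
  familyC G <-> is_tree G /\ exists m, triple_matching G m.
Proof.
split=> [[tG dG [M [sM M1]]]|[tG [m [m_sym m_adj m_deg m1]]]].
  split=> //; pose D := {v | v \in [set v | degree G v == 3]}.
  pose m u v := [exists a : D, exists b : D,
    [&& val a == u, val b == v & [set a; b] \in M]].
  have mE (a : D) v : m (val a) v = [exists b : D, (val b == v) && ([set a; b] \in M)].
    apply/existsP/existsP => [[a' /existsP[b /and3P[/eqP/val_inj-> bv abM]]]|[b bP]].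
      by exists b; rewrite bv abM.
    by exists a; apply/existsP; exists b; rewrite eqxx.
  have mD u v : m u v -> (degree G u == 3) && (degree G v == 3).
    case/existsP=> a /existsP[b /and3P[/eqP <- /eqP <- _]].
    by have := valP a; have := valP b; rewrite !inE => -> ->.
  exists m; split=> //.
  - have sym1 u v : m u v -> m v u.
      case/existsP=> a /existsP[b /and3P[au bv abM]].
      by apply/existsP; exists b; apply/existsP; exists a; rewrite au bv setUC.
    by move=> u v; apply/idP/idP; apply: sym1.
  - move=> u v /existsP[a /existsP[b /and3P[/eqP <- /eqP <- abM]]].
    by have := subsetP sM _ abM; rewrite mem_edges.
  - move=> v; have [dv|dv] := eqVneq (degree G v) 3; last first.
      apply/eqP; rewrite cards_eq0; apply/eqP/setP => c; rewrite !inE.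
      by apply/negbTE/negP => /mD/andP[/eqP dv3]; rewrite dv3 eqxx in dv.
    have vD : v \in [set v | degree G v == 3] by rewrite inE dv.
    apply: etrans (M1 (Sub v vD)); rewrite (card_matched_edges _ sM).
    rewrite -(card_imset _ val_inj); apply: eq_card => c; rewrite inE.
    have -> := mE (Sub v vD : D) c.
    apply/existsP/imsetP => [[b /andP[/eqP <- bM]]|[b]]; first by exists b; rewrite ?inE.
    by rewrite inE => bM ->; exists b; rewrite eqxx.
split=> //.
pose D := {v | v \in [set v | degree G v == 3]}.
pose M := [set f in edges (D3 G) | [exists a : D, exists b : D,
  (f == [set a; b]) && m (val a) (val b)]].
exists M; split; first by apply/subsetP => f; rewrite inE => /andP[].
move=> a; rewrite (card_matched_edges (G := D3 G)); last first.
  by apply/subsetP => f; rewrite inE => /andP[].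
have ME b : ([set a; b] \in M) = m (val a) (val b).
  rewrite inE mem_edges; apply/andP/idP => [[_ /existsP[a' /existsP[b' /andP[]]]]|mab].
    by rewrite set2_eq => /orP[]/andP[/eqP-> /eqP->] //; rewrite m_sym.
  split; first exact: m_adj mab.
  by apply/existsP; exists a; apply/existsP; exists b; rewrite eqxx.
have /eqP da : degree G (val a) == 3 by have := valP a; rewrite inE.
apply: etrans (_ : #|[set c | m (val a) c]| = 1); last by rewrite m1 da.
rewrite -(card_sub_val (S := [set v | degree G v == 3])).
  by apply: eq_card => b; rewrite [LHS]in_set ME [RHS]in_set.
(* A partner of degree other than 3 would have no partner itself, but [val a] is one. *)
move=> c mac; rewrite inE; apply: contraT => dc; have := m1 c; rewrite (negbTE dc) => /eqP.
rewrite cards_eq0 => /eqP/setP/(_ (val a)); by rewrite !inE m_sym mac.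
Qed.

(** * Components of a forest, and gluing matchings over them *)

Lemma acyclic_sub (V W : finType) (G : sgraph V) (H : sgraph W) (f : W -> V) :
  injective f -> (forall x y, adj H x y -> adj G (f x) (f y)) ->
  acyclic_graph G -> acyclic_graph H.
Proof.
move=> f_inj fP acG c /andP[cH cU].
have : ucycle (adj G) (map f c).
  rewrite /ucycle map_inj_uniq // cU andbT.
  by rewrite cycle_map; apply: sub_cycle cH => x y; apply: fP.
by move/acG; rewrite size_map.
Qed.

Section Components.
Variables (V : finType) (G : sgraph V).

Lemma component_adj u v : adj G u v -> component G u = component G v.
Proof.
move=> uv; apply/setP => x; rewrite !inE.
by apply: (same_connect (connect_adj_sym G)); apply: connect1.
Qed.

Lemma mem_componentE S v : S \in components G -> v \in S -> S = component G v.
Proof.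
case/imsetP=> u _ ->; rewrite inE => uv; apply/setP => x; rewrite !inE.
by rewrite (same_connect (connect_adj_sym G) uv).
Qed.

Lemma components_closed S u v : S \in components G -> adj G u v -> u \in S -> v \in S.
Proof.
move=> SG uv uS; rewrite (mem_componentE SG uS) (component_adj uv).
by rewrite inE connect0.
Qed.

Lemma degree_induced (S : {set V}) (a : {v | v \in S}) : S \in components G ->
  degree (induced G S) a = degree G (val a).
Proof.
move=> SG; rewrite !degreeE -(card_sub_val (S := S)) // => c ac.
exact: components_closed SG ac (valP a).
Qed.

Lemma induced_component_tree (S : {set V}) : acyclic_graph G -> S \in components G ->
  is_tree (induced G S).
Proof.
move=> acG SG; split; last exact: acyclic_sub val_inj _ acG.
have /imsetP[r _ SE] := SG; have rS : r \in S by rewrite SE inE connect0.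
split; first by apply/card_gt0P; exists (Sub r rS).
(* Quantifying over the subtype elements above [y] lets connectivity be propagated along vertices of
   [V]. *)
move=> a b; pose P y := [forall d : {v | v \in S}, (val d == y) ==>
  connect (adj (induced G S)) a d] && (y \in S).
suff : P (val b) by case/andP=> /forallP/(_ b); rewrite eqxx.
have ab : connect (adj G) (val a) (val b).
  have /setP/(_ (val b)) := mem_componentE SG (valP a).
  by rewrite (valP b) inE => /esym.
apply: (connect_propagate _ ab) => [p q /andP[/forallP Pp pS] pq|].
  have qS := components_closed SG pq pS; rewrite /P qS andbT.
  apply/forallP => d; apply/implyP => /eqP dq.
  have := Pp (Sub p pS); rewrite SubK eqxx /= => ap.
  by apply: connect_trans ap (connect1 _); rewrite /= /induced_adj /= [sval d]dq.
rewrite /P (valP a) andbT; apply/forallP => d; apply/implyP => /eqP/val_inj ->.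
exact: connect0.
Qed.

End Components.

(** A matching relation stays inside components, hence restricts to them. Conversely, one is chosen
    for each component and [u] uses that of its own component; adjacent vertices use the same
    one. *)
Lemma components_triple_matching (V : finType) (G : sgraph V) : acyclic_graph G ->
  (forall S, S \in components G -> familyC (induced G S)) <->
  exists m, triple_matching G m.
Proof.
move=> acG; split=> [famC|[m [m_sym m_adj m_deg m1]] S SG]; last first.
  apply/familyC_triple_matching; split; first exact: induced_component_tree.
  exists (fun a b => m (val a) (val b)); split.
  - by move=> a b; rewrite m_sym.
  - by move=> a b; apply: m_adj.
  - by move=> a; rewrite degree_induced.
  - move=> a; rewrite degree_induced // -m1 (card_sub_val (P := m (val a))) // => c mac.
    exact: components_closed SG (m_adj _ _ mac) (valP a).
have /choice[M MP] : forall S : {set V}, exists m : rel V, S \in components G ->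
    [/\ symmetric m, (forall u v, m u v -> adj G u v),
        forall v, v \in S -> degree G v = 1 \/ degree G v = 3 &
        forall v, v \in S -> #|[set c | m v c]| = (degree G v == 3)].
  move=> S; have [SG|] := boolP (S \in components G); last by exists (fun _ _ => true).
  have /familyC_triple_matching[_ [m [m_sym m_adj m_deg m1]]] := famC S SG.
  pose m' u v := [exists a : {v | v \in S}, exists b : {v | v \in S},
    [&& val a == u, val b == v & m a b]].
  have m'E (a b : {v | v \in S}) : m' (val a) (val b) = m a b.
    apply/existsP/idP => [[a' /existsP[b' /and3P[/eqP/val_inj-> /eqP/val_inj-> //]]]|mab].
    by exists a; apply/existsP; exists b; rewrite !eqxx.
  have m'S u v : m' u v -> (u \in S) && (v \in S).
    by case/existsP=> a /existsP[b /and3P[/eqP <- /eqP <- _]]; rewrite (valP a) (valP b).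
  exists m' => _; split.
  - have sym1 u v : m' u v -> m' v u.
      case/existsP=> a /existsP[b /and3P[au bv ab]].
      by apply/existsP; exists b; apply/existsP; exists a; rewrite au bv m_sym.
    by move=> u v; apply/idP/idP; apply: sym1.
  - by move=> u v /existsP[a /existsP[b /and3P[/eqP <- /eqP <- /m_adj]]].
  - by move=> v vS; have := m_deg (Sub v vS); rewrite degree_induced.
  - move=> v vS; have := m1 (Sub v vS); rewrite degree_induced // => <-.
    rewrite -(card_sub_val (S := S)); last by move=> c /m'S/andP[].
    by apply: eq_card => b; rewrite !inE; apply: (m'E (Sub v vS)).
have inC v : component G v \in components G by apply: imset_f.
have inCv v : v \in component G v by rewrite inE connect0.
exists (fun u v => M (component G u) u v); split.
- have sym1 u v : M (component G u) u v -> M (component G v) v u.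
    have [M_sym M_adj _ _] := MP _ (inC u) => uv.
    by rewrite -(component_adj (M_adj _ _ uv)) M_sym.
  by move=> u v; apply/idP/idP; apply: sym1.
- by move=> u v; have [_ M_adj _ _] := MP _ (inC u); apply: M_adj.
- by move=> v; have [_ _ M_deg _] := MP _ (inC v); apply: M_deg.
- by move=> v; have [_ _ _ M1] := MP _ (inC v); apply: M1.
Qed.

(** * Sums of signs *)

Section Signs.
Local Open Scope ring_scope.

Definition sgnb (b : bool) : int := if b then 1 else -1.

Lemma sgnb_negb b : sgnb (~~ b) = - sgnb b.
Proof. by case: b; rewrite //= opprK. Qed.

Lemma sum_sgnb (V : finType) (N : pred V) (h : V -> bool) :
  \sum_(c | N c) sgnb (h c) = 2 * #|[set c | N c & h c]|%:Z - #|[set c | N c]|%:Z.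
Proof.
have -> : #|[set c | N c]| = (#|[set c | N c & h c]| + #|[set c | N c & ~~ h c]|)%N.
  rewrite -(cardsID [set c | h c]); congr (_ + _)%N; apply: eq_card => c;
    by rewrite !inE // andbC.
rewrite (bigID h) /= (eq_bigr (fun=> 1)); last by move=> c /andP[_ ->].
rewrite [X in _ + X](eq_bigr (fun=> -1)); last by move=> c /andP[_ /negbTE ->].
by rewrite !sumr_const !cardsE mulNrn !natz; lia.
Qed.

(* If three signs agree, c is the matched neighbour; if not, it is an unmatched
   one carrying the majority sign. *)
Lemma sum_sgnb_triple (V : finType) (G : sgraph V) (m : rel V) v (h : V -> bool) :
  triple_matching G m -> exists2 c, adj G v c &
    \sum_(c | adj G v c) sgnb (h c) = sgnb (h c) * (if m v c then 3 else 1).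
Proof.
case=> _ m_adj m_deg m1; have := m1 v; have := m_deg v; rewrite degreeE.
case=> [/eqP/cards1P[c cE] | N3].
  rewrite cE cards1 => /eqP; rewrite cards_eq0 => /eqP m0.
  have vc : adj G v c by have /setP/(_ c) := cE; rewrite !inE eqxx.
  exists c => //; have /setP/(_ c) := m0; rewrite !inE => ->; rewrite mulr1.
  apply: big_pred1 => x; by have /setP/(_ x) := cE; rewrite !inE.
rewrite N3 eqxx => /eqP/cards1P[c1 cE].
have mE x : m v x = (x == c1) by have /setP/(_ x) := cE; rewrite !inE.
have vc1 : adj G v c1 by apply: m_adj; rewrite mE.
have /eqP/cards2P[c2 [c3 [n23 NE]]] : #|[set c | adj G v c] :\ c1| = 2.
  by have := cardsD1 c1 [set c | adj G v c]; rewrite N3 inE vc1 => -[].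
have adjE x : x != c1 -> adj G v x = (x == c2) || (x == c3).
  by move=> x1; have /setP/(_ x) := NE; rewrite !inE x1.
have n21 : c2 != c1 by have /setP/(_ c2) := NE; rewrite !inE eqxx => /andP[].
have n31 : c3 != c1 by have /setP/(_ c3) := NE; rewrite !inE eqxx orbT => /andP[].
have vc2 : adj G v c2 by rewrite adjE // eqxx.
have vc3 : adj G v c3 by rewrite adjE // eqxx orbT.
rewrite (bigD1 c1) //= (bigD1 c2) ?vc2 //= (big_pred1 c3); last first.
  move=> x; rewrite /=; have [->|x1] /= := eqVneq x c1.
    by rewrite andbF /= eq_sym (negbTE n31).
  rewrite adjE // andbT; have [->|x2] /= := eqVneq x c2; last by rewrite andbT.
  by rewrite (negbTE n23).
case h1: (h c1); case h2: (h c2); case h3: (h c3);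
  first [by exists c1; rewrite ?mE ?eqxx ?h1 | by exists c2; rewrite ?mE ?(negbTE n21) ?h2
        | by exists c3; rewrite ?mE ?(negbTE n31) ?h3].
Qed.

End Signs.

(** * Weights 1 and -1 *)

Section OppositeWeights.
Variables (V : finType) (T : sgraph V).
Local Open Scope ring_scope.
Hypothesis treeT : is_tree T.
Implicit Types (u v c : V) (b : bool) (A C : {set V}).

(** On an edge swapped by [F], both weighted degrees are read from the same sign and the same
    matching bit. *)
Lemma triple_not_colourable m : triple_matching T m -> ~ colourable T sgnb.
Proof.
move=> mP [w w_sym w_proper].
have /choice[F FP] : forall v, exists c, adj T v c /\
    wsum T sgnb w v = sgnb (w v c) * (if m v c then 3 else 1).
  by move=> v; have [c vc E] := sum_sgnb_triple v (w v) mP; exists c.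
have [|v vF FF] := @neighbour_map_swap V T treeT F; first by move=> v; have [] := FP v.
have := w_proper _ _ vF; have [_ ->] := FP v; have [_ ->] := FP (F v); rewrite FF.
by have [m_sym _ _ _] := mP; rewrite m_sym (w_sym _ _ vF) eqxx.
Qed.

Notation reachT := (reach T sgnb).

(** Negating every weight negates every weighted degree. *)
Lemma reach_opp u v b x : reachT u v b x -> reachT u v (~~ b) (- x).
Proof.
elim=> {u v b x} u v h y _ IH H2.
rewrite -sumrN (eq_bigr (fun c => sgnb (~~ h c))); last by move=> c _; rewrite sgnb_negb.
apply: (reachI (h := fun c => ~~ h c)) => c vc cu; exists (- y c); first exact: IH.
rewrite (eq_bigr (fun c => - sgnb (h c))); last by move=> d _; rewrite sgnb_negb.
by rewrite sumrN eqr_opp; apply: H2.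
Qed.

Lemma sum_sgnb_set v A : A \subset [set c | adj T v c] ->
  \sum_(c | adj T v c) sgnb (c \in A) = 2 * #|A|%:Z - (degree T v)%:Z.
Proof.
move=> sA; rewrite sum_sgnb degreeE; congr (2 * _%:Z - _); apply: eq_card => c.
by rewrite !inE; apply: andb_idl => /(subsetP sA); rewrite inE.
Qed.

Lemma reach_odd u v b x : reachT u v b x -> odd `|x| = odd (degree T v).
Proof. by case/reach_inv=> h [_ -> _]; rewrite sum_sgnb -degreeE; lia. Qed.

(* k is the number of positive edges from v to C, and z the sum of the weights
   of the other edges at v. *)
Definition sgn_blocked v (C : {set V}) z b c (k : nat) : bool :=
  `[< forall y, reachT v c b y -> y = z + 2 * k%:Z - #|C|%:Z >].

(** The invariant of all branches. With two values a branch never blocks; at odd degree its values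
    are odd, which restricts when it can block. *)
Definition flexible v c : Prop :=
  (forall b, exists x, reachT v c b x) /\
  (odd (degree T c) \/ forall b, exists x y, [/\ x != y, reachT v c b x & reachT v c b y]).

(** Blocking excludes two values, so the degree of [c] is odd and so is the blocked value. *)
Lemma sgn_blocked_odd v C z b c k : flexible v c -> sgn_blocked v C z b c k ->
  odd `|z - #|C|%:Z|.
Proof.
move=> [ne [od|two]] /asboolP bl.
  have [y ry] := ne b; have := reach_odd ry; rewrite od (bl y ry); lia.
by have [x [y [xy /bl xE /bl yE]]] := two b; rewrite xE yE eqxx in xy.
Qed.

(** Applies [stuck_structure]. By [reach_opp] the blocked values for the two signs are opposite,
    whence [k + l = #|C| - z], which is odd. *)
Lemma sgn_stuck_structure v C z :
  (forall c, c \in C -> flexible v c) ->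
  (forall A, A \subset C -> exists2 c, c \in C &
     forall y, reachT v c (c \in A) y -> y = z + 2 * #|A|%:Z - #|C|%:Z) ->
  [/\ #|C| = 1%N \/ #|C| = 3%N,
      forall c, c \in C -> (sgn_blocked v C z false c 0 /\ sgn_blocked v C z true c #|C|) \/
        [/\ #|C| = 3%N, sgn_blocked v C z false c 1 & sgn_blocked v C z true c 2] &
      #|[set c in C | sgn_blocked v C z true c 3]| = (#|C| == 3%N)].
Proof.
move=> flex stuck; apply: stuck_structure.
- move=> c k l cC /asboolP bk /asboolP bl; have [/(_ false)[y ry] _] := flex c cC.
  by have := bk y ry; have := bl y ry; lia.
- move=> c k l cC /asboolP bk /asboolP bl; have [/(_ true)[y ry] _] := flex c cC.
  by have := bk y ry; have := bl y ry; lia.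
- move=> c k l cC bk bl; have := sgn_blocked_odd (flex c cC) bk.
  move: bk bl => /asboolP bk /asboolP bl; have [/(_ false)[y ry] _] := flex c cC.
  by have := bk y ry; have := bl _ (reach_opp ry); lia.
- move=> A sA; have [c cC bl] := stuck A sA; exists c => //.
  by case: ifP bl => _ bl; apply/asboolP.
Qed.

(** Induction on the size of the branch, [C] being the neighbours of [v] other than [u]. At odd
    degree [#|C|] is even, hence not 1 or 3, and some assignment is not stuck. At even degree no
    neighbour in [C] blocks, by parity, and the assignments [set0] and [C] give different values. *)
Lemma branch_flexible u v : adj T u v -> flexible u v.
Proof.
have [n] := ubnP #|branch T u v|; elim: n u v => // n IH u v + uv.
rewrite ltnS => ltB; have vu : adj T v u by rewrite adj_sym.
pose C := [set c | adj T v c] :\ u.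
have uN : u \in [set c | adj T v c] by rewrite inE.
have dC : degree T v = #|C|.+1 by rewrite degreeE (cardsD1 u) uN.
have flex c : c \in C -> flexible v c.
  rewrite !inE => /andP[cu vc]; apply: IH => //.
  exact: leq_trans (branch_card_lt treeT uv vc cu) ltB.
have valid b A : A \subset C -> let x := sgnb b + 2 * #|A|%:Z - #|C|%:Z in
    (forall c, c \in C -> exists2 y, reachT v c (c \in A) y & y != x) -> reachT u v b x.
  move=> sA x ok; pose A' := if b then u |: A else A.
  have uA : u \notin A by apply/negP => /(subsetP sA); rewrite !inE eqxx.
  have uA' : (u \in A') = b by rewrite /A'; case: b {ok x A'}; rewrite ?setU11 ?(negbTE uA).
  have cA' c : c != u -> (c \in A') = (c \in A).
    by move=> cu; rewrite /A'; case: (b) => //; rewrite in_setU1 (negbTE cu).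
  have xE : \sum_(c | adj T v c) sgnb (c \in A') = x.
    rewrite sum_sgnb_set.
      rewrite /x /A' dC; case: (b); rewrite ?cardsU1 ?uA /= /sgnb; lia.
    rewrite /A'; case: (b); rewrite ?subUset ?sub1set ?uN /=;
      exact: subset_trans sA (subsetDl _ _).
  rewrite -{1}uA' -xE; apply: (reachI (h := fun c => c \in A')) => c vc cu.
  by rewrite xE cA' //; apply: ok; rewrite !inE cu.
have [od|ev] := boolP (odd (degree T v)).
  split; last by left.
  move=> b; apply: contrapT => none.
  have [A sA|C13 _ _] := @sgn_stuck_structure v C (sgnb b) flex.
    apply: contrapT => ok; case: none; exists (sgnb b + 2 * #|A|%:Z - #|C|%:Z).
    apply: valid => // c cC; apply: contrapT => nok; case: ok; exists c => // y ry.
    by apply: contrapT => /eqP ny; case: nok; exists y.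
  by move: od; rewrite dC; case: C13 => ->.
have all_ok b A : A \subset C -> reachT u v b (sgnb b + 2 * #|A|%:Z - #|C|%:Z).
  move=> sA; apply: valid => // c cC; apply: contrapT => nok.
  have : sgn_blocked v C (sgnb b) (c \in A) c #|A|.
    by apply/asboolP => y ry; apply: contrapT => /eqP ny; case: nok; exists y.
  move/(sgn_blocked_odd (flex c cC)); move: ev; rewrite dC /sgnb; case: (b); lia.
have C0 : (0 < #|C|)%N by move: ev; rewrite dC; case: #|C|.
split=> [b|]; first by exists (sgnb b + 2 * #|C|%:Z - #|C|%:Z); apply: all_ok.
right=> b; exists (sgnb b + 2 * #|@set0 V|%:Z - #|C|%:Z), (sgnb b + 2 * #|C|%:Z - #|C|%:Z).
by split; [rewrite cards0; lia | apply/all_ok/sub0set | apply: all_ok].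
Qed.

(** [sgn_stuck_structure] applies at every vertex to all its neighbours, with [z = 0]. The matched
    edges are those whose far end is forced to 3 under weight 1; this is symmetric because the
    values at the two ends of an edge must coincide. *)
Lemma not_colourable_triple : ~ colourable T sgnb -> exists m, triple_matching T m.
Proof.
move=> nc; pose N v := [set c | adj T v c].
have edge u v b x y : adj T u v -> reachT u v b x -> reachT v u b y -> x = y.
  move=> uv rx ry; apply: contrapT => /eqP xy; exact: nc (colourable_edge treeT uv rx ry xy).
have flex v c : c \in N v -> flexible v c by rewrite inE; apply: branch_flexible.
have str v := @sgn_stuck_structure v (N v) 0 (@flex v).
have {}str v : [/\ #|N v| = 1%N \/ #|N v| = 3%N,
      forall c, c \in N v -> (sgn_blocked v (N v) 0 false c 0 /\ sgn_blocked v (N v) 0 true c #|N v|) \/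
        [/\ #|N v| = 3%N, sgn_blocked v (N v) 0 false c 1 & sgn_blocked v (N v) 0 true c 2] &
      #|[set c in N v | sgn_blocked v (N v) 0 true c 3]| = (#|N v| == 3%N)].
  apply: str => A sA; apply: contrapT => nok; apply: nc.
  apply: (colourable_star treeT (v := v) (h := fun c => c \in A)) => c vc.
  rewrite sum_sgnb_set //; apply: contrapT => bl; case: nok; exists c; first by rewrite inE.
  move=> y ry; apply: contrapT => /eqP ny; case: bl; exists y => //.
  by rewrite degreeE; move: ny; rewrite add0r.
pose m v c := adj T v c && `[< forall y, reachT v c true y -> y = 3 >].
exists m; split.
- have sym1 u v : m u v -> m v u.
    case/andP=> uv /asboolP m3; rewrite /m adj_sym uv; apply/asboolP => y ry.
    have [/(_ true)[x rx] _] := branch_flexible uv.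
    by rewrite -(edge _ _ _ _ _ uv rx ry); apply: m3.
  by move=> u v; apply/idP/idP; apply: sym1.
- by move=> u v /andP[].
- by move=> v; rewrite degreeE; have [] := str v.
- move=> v; rewrite degreeE -/(N v); have [] := str v; move=> C13 blk <-.
  apply: eq_card => c; rewrite [LHS]in_set [RHS]in_set /m -[adj T v c](in_set (adj T v)).
  have [vc|//] := boolP (c \in N v); rewrite /=.
  have [/(_ true)[y ry] _] := flex v c vc.
  (* For one neighbour the forced value is 1, so neither condition holds; for three, being blocked
     at 3 means being forced to [2 * 3 - 3]. *)
  case: C13 => Nv.
    have [[_ /asboolP b1]|[]] := blk c vc; last by rewrite Nv.
    have y1 := b1 y ry; rewrite Nv in y1.
    apply/asboolP/asboolP => [/(_ y ry)|/(_ y ry)]; rewrite ?Nv; lia.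
  by rewrite /sgn_blocked Nv; apply/asboolP/asboolP => H z /H; lia.
Qed.

Lemma opposite_weights : ~ colourable T sgnb <-> familyC T.
Proof.
rewrite familyC_triple_matching; split=> [/not_colourable_triple|[_ [m]]]; first by split.
exact: triple_not_colourable.
Qed.

End OppositeWeights.

(** * Odd bipartition classes and the orientation of nonskeleton edges *)

Lemma odd_sum_odd (I : finType) (P : pred I) (F : I -> nat) :
  odd (\sum_(i | P i) odd (F i)) = odd (\sum_(i | P i) F i).
Proof.
rewrite !(big_morph odd oddD (erefl : odd 0 = false)).
by apply: eq_bigr => i _; rewrite oddb.
Qed.

Section OddClasses.
Variables (V : finType) (T : sgraph V) (X Y : {set V}).
Hypothesis treeT : is_tree T.
Hypothesis XYT : X :|: Y = [set: V].
Hypothesis XY_disj : [disjoint X & Y].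
Hypothesis oddX : odd #|X|.
Hypothesis oddY : odd #|Y|.
Implicit Types (u v c : V) (B : {set V}).

Lemma card_classes B : #|B| = #|B :&: X| + #|B :&: Y|.
Proof.
rewrite -(cardsID X B); congr (_ + _); apply: eq_card => x; rewrite !inE.
have /setP/(_ x) := XYT; rewrite !inE.
have [xX|_ /= ->] := boolP (x \in X); last by rewrite andbT.
by rewrite (disjointFr XY_disj xX) andbF.
Qed.

Lemma branch_flip u v : adj T u v -> branch T v u = ~: branch T u v.
Proof. by move=> uv; apply/setP => x; rewrite in_setC -(branch_compl treeT). Qed.

Lemma odd_branch_flip (Z : {set V}) u v : odd #|Z| -> adj T u v ->
  odd #|branch T v u :&: Z| = ~~ odd #|branch T u v :&: Z|.
Proof.
move=> oddZ uv; rewrite branch_flip // [_ :&: Z]setIC -setDE.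
move: oddZ; rewrite -(cardsID (branch T u v) Z) oddD setIC.
by case: (odd _); case: (odd _).
Qed.

(** The total order is even, so a nonskeleton edge has two even sides; on an even side the parities
    of [X] and [Y] agree, and [directed] records them. *)
Lemma nonskeleton_parity u v : adj T u v -> ~~ adj (skeleton T) u v ->
  odd #|branch T u v :&: X| = directed T X Y u v /\
  odd #|branch T u v :&: Y| = directed T X Y u v.
Proof.
move=> uv ns; rewrite directedE ns uv /=; move: ns; rewrite skeletonE // uv /=.
rewrite (card_classes (branch T u v)) (card_classes (branch T v u)) !oddD.
rewrite (odd_branch_flip oddX uv) (odd_branch_flip oddY uv).
by case: (odd _); case: (odd _).
Qed.

Lemma skeleton_parity u v : adj (skeleton T) u v ->
  odd #|branch T u v :&: Y| = ~~ odd #|branch T u v :&: X|.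
Proof.
rewrite skeletonE // (card_classes (branch T u v)) oddD => /and3P[_ + _].
by case: (odd _); case: (odd _).
Qed.

Lemma directed_flip u v : adj T u v -> ~~ adj (skeleton T) u v ->
  directed T X Y v u = ~~ directed T X Y u v.
Proof.
move=> uv ns; have vu : adj T v u by rewrite adj_sym.
have ns' : ~~ adj (skeleton T) v u by rewrite adj_sym.
have [<- _] := nonskeleton_parity uv ns; have [<- _] := nonskeleton_parity vu ns'.
exact: odd_branch_flip.
Qed.

Lemma skeleton_adj_tree u v : adj (skeleton T) u v -> adj T u v.
Proof. by case/andP. Qed.

Lemma directed_nonskeleton u v : directed T X Y u v -> adj T u v && ~~ adj (skeleton T) u v.
Proof. by rewrite directedE => /and4P[-> ->]. Qed.

(** Off the skeleton [h] follows the orientation, so the edges selected there are those counted by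
    [load]. *)
Lemma card_out v (h : V -> bool) :
  (forall c, adj T v c -> ~~ adj (skeleton T) v c -> h c = directed T X Y v c) ->
  #|[set c | adj T v c & h c]| =
  load T X Y v + #|[set c | adj (skeleton T) v c & h c]|.
Proof.
move=> hns; rewrite -(cardsID [set c | adj (skeleton T) v c]) addnC; congr (_ + _).
  apply: eq_card => c; rewrite in_setD !in_set.
  have [sk|ns] := boolP (adj (skeleton T) v c).
    by apply/esym/negP => /directed_nonskeleton; rewrite sk andbF.
  have [vc|nvc] := boolP (adj T v c); first by rewrite hns.
  by apply/esym/negP => /directed_nonskeleton/andP[vc]; rewrite vc in nvc.
apply: eq_card => c; rewrite in_setI !in_set andbAC; congr (_ && _).
by apply: andb_idl; apply: skeleton_adj_tree.
Qed.

Local Open Scope ring_scope.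

Definition bit (b : bool) : int := (b : nat)%:Z.

Lemma sum_bit (N : pred V) (h : V -> bool) :
  \sum_(c | N c) bit (h c) = #|[set c | N c & h c]|%:Z.
Proof.
rewrite (eq_bigr (fun c => if h c then 1 else 0)); last by move=> c _; rewrite /bit; case: h.
by rewrite -big_mkcondr sumr_const cardsE natz.
Qed.

(* Each endpoint of a nonskeleton edge wants the weight prescribed by its own
   outgoing orientation, so that exactly one of them is dissatisfied. *)
Lemma triple_skeleton_not_colourable m :
  triple_matching (skeleton T) m ->
  (forall u v, adj (skeleton T) u v -> adjusted_load T X Y u = adjusted_load T X Y v) ->
  ~ colourable T bit.
Proof.
move=> mP load_const [w w_sym w_proper].
(* [F v] is a neighbour whose nonskeleton edge defies the orientation at [v]. If there is none,
   twice the weighted degree minus the adjusted load is a signed sum over the skeleton, to which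
   [sum_sgnb_triple] applies. *)
have /choice[F FP] : forall v, exists c, adj T v c /\
    (if adj (skeleton T) v c
     then 2 * wsum T bit w v =
       (adjusted_load T X Y v)%:Z + sgnb (w v c) * (if m v c then 3 else 1)
     else w v c != directed T X Y v c).
  move=> v; have [/existsP[c /and3P[vc ns wc]]|/existsPn ok] :=
      boolP [exists c, [&& adj T v c, ~~ adj (skeleton T) v c &
        w v c != directed T X Y v c]].
    by exists c; rewrite (negbTE ns).
  have [c vc E] := sum_sgnb_triple v (w v) mP.
  exists c; rewrite vc; split; first exact: skeleton_adj_tree.
  rewrite -E sum_sgnb /wsum sum_bit card_out.
    by rewrite /adjusted_load degreeE; lia.
  by move=> d vd ns; apply/eqP; have := ok d; rewrite vd ns /= negbK.
have [|v vF FF] := @neighbour_map_swap V T treeT F; first by move=> v; have [] := FP v.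
have [_] := FP (F v); have [_] := FP v; rewrite FF [adj _ (F v) v]adj_sym.
have [sk|ns] := ifPn; last first.
  by rewrite (directed_flip vF ns) -(w_sym _ _ vF); case: (w _ _); case: directed.
have [m_sym _ _ _] := mP.
rewrite (load_const _ _ sk) [m (F v) v]m_sym -(w_sym _ _ vF) => <- E.
by have /eqP := w_proper _ _ vF; lia.
Qed.

End OddClasses.

(** * Consequences of having no proper weighting with values 0 and 1 *)

Section UnitWeights.
Variables (V : finType) (T : sgraph V).
Hypothesis treeT : is_tree T.
Hypothesis nc : ~ colourable T bit.
Variable col : V -> bool.
Hypothesis colP : forall u v, adj T u v -> col u = ~~ col v.
Implicit Types (u v c : V) (b t : bool) (A : {set V}).
Local Open Scope ring_scope.

Notation reachT := (reach T bit).
Let K t := [set v | col v == t].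

Lemma card_setI_class (B : {set V}) t : (#|B :&: K t| = \sum_(x in B) (col x == t))%N.
Proof.
rewrite -sum1_card big_mkcond [RHS]big_mkcond; apply: eq_bigr => x _.
by rewrite !inE; case: (x \in B); case: eqP.
Qed.

Lemma odd_abs_sum_bit (N : pred V) (h : V -> bool) :
  odd `|\sum_(c | N c) bit (h c)| = odd (\sum_(c | N c) h c).
Proof.
rewrite sum_bit absz_nat; congr odd.
by rewrite -sum1dep_card big_mkcondr; apply: eq_bigr => c _; case: (h c).
Qed.

Lemma col_eqb u v t : adj T u v -> (col u == t) = ~~ (col v == t).
Proof. by move=> /colP ->; case: (col v); case: t. Qed.

(* Give every edge the parity of the number of vertices of colour t behind it:
   then exactly the vertices of colour t have odd weighted degree. *)
Lemma reach_parity u v t : adj T u v ->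
  exists2 x, reachT u v (odd #|branch T u v :&: K t|) x & odd `|x| = (col v == t).
Proof.
have [n] := ubnP #|branch T u v|; elim: n u v => // n IH u v + uv.
rewrite ltnS => ltB; have vu : adj T v u by rewrite adj_sym.
pose h c := if c == u then odd #|branch T u v :&: K t| else odd #|branch T v c :&: K t|.
(* By [sum_branch], the count behind [uv] is [col v == t] plus the counts behind the other edges at
   [v], which therefore cancel modulo 2. *)
have xP : odd `|\sum_(c | adj T v c) bit (h c)| = (col v == t).
  rewrite odd_abs_sum_bit (bigD1 u) //= oddD /h eqxx oddb.
  rewrite (eq_bigr (fun c => odd #|branch T v c :&: K t| : nat)); last first.
    by move=> c /andP[_ /negbTE ->].
  rewrite odd_sum_odd !card_setI_class (sum_branch treeT _ uv) oddD oddb.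
  rewrite (eq_bigr (fun c => #|branch T v c :&: K t|)) => [|c _]; last first.
    by rewrite card_setI_class.
  rewrite [X in _ (+) odd X](eq_bigr (fun c => #|branch T v c :&: K t|)) //.
  by rewrite -addbA addbb addbF.
exists (\sum_(c | adj T v c) bit (h c)) => //.
have {1}-> : odd #|branch T u v :&: K t| = h u by rewrite /h eqxx.
apply: reachI => c vc cu.
have [|y ry yP] := IH v c _ vc; first exact: leq_trans (branch_card_lt treeT uv vc cu) ltB.
exists y; first by rewrite /h (negbTE cu).
by apply/eqP => yE; move: yP; rewrite yE xP (col_eqb _ vc); case: eqP.
Qed.

(** If the class were even, the parity weighting could be closed up at any root [r]: the counts
    behind its edges would add up to the parity [col r == t], and adjacent weighted degrees would
    differ in parity. *)
Lemma odd_class t : odd #|K t|.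
Proof.
apply: contrapT => /negP ev; apply: nc.
have [r _] : exists r : V, true by case/card_gt0P: treeT.1.1 => r; exists r.
pose h c := odd #|branch T r c :&: K t|.
have xP : odd `|\sum_(c | adj T r c) bit (h c)| = (col r == t).
  rewrite odd_abs_sum_bit odd_sum_odd; move: ev.
  have -> : #|K t| = #|[set: V] :&: K t| by rewrite setTI.
  rewrite card_setI_class.
  rewrite (eq_bigl xpredT) => [|x]; last by rewrite inE.
  rewrite (sum_star treeT _ r) oddD oddb.
  rewrite (eq_bigr (fun c => #|branch T r c :&: K t|)) => [|c _]; last first.
    by rewrite card_setI_class.
  by case: (_ == t); case: (odd _).
apply: (colourable_star treeT (v := r) (h := h)) => c rc.
have [y ry yP] := reach_parity t rc; exists y => //.
by apply/eqP => yE; move: yP; rewrite yE xP (col_eqb _ rc); case: eqP.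
Qed.

Lemma classes_cover : K true :|: K false = [set: V].
Proof. by apply/setP => x; rewrite !inE; case: (col x). Qed.

Lemma classes_disjoint : [disjoint K true & K false].
Proof.
by apply/pred0P => x; rewrite /= !inE; case: (col x).
Qed.

Notation dir := (directed T (K true) (K false)).

Lemma edge_value u v b x y : adj T u v -> reachT u v b x -> reachT v u b y -> x = y.
Proof.
move=> uv rx ry; apply: contrapT => /eqP xy; exact: nc (colourable_edge treeT uv rx ry xy).
Qed.

(** The parity weightings for the two colours give the edge the same value, its orientation bit, but
    give [v] opposite parities. *)
Lemma nonskeleton_two_values u v : adj T u v -> ~~ adj (skeleton T) u v ->
  exists x y, [/\ x != y, reachT u v (dir u v) x & reachT u v (dir u v) y].
Proof.
move=> uv ns.
have [x] := reach_parity true uv; have [y] := reach_parity false uv.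
have [-> ->] := nonskeleton_parity treeT classes_cover classes_disjoint
  (odd_class true) (odd_class false) uv ns.
move=> ry oy rx ox; exists x, y; split=> //.
by apply/eqP => xy; move: oy; rewrite -xy ox; case: (col v).
Qed.

(** Behind a skeleton edge the counts of the two colours differ in parity, so the two parity
    weightings use both edge values. *)
Lemma skeleton_values u v : adj (skeleton T) u v ->
  exists x y, [/\ reachT u v false x, reachT u v true y & odd `|x| != odd `|y|].
Proof.
move=> sk; have uv := skeleton_adj_tree sk.
have [x] := reach_parity true uv; have [y] := reach_parity false uv.
rewrite (skeleton_parity treeT classes_cover classes_disjoint sk).
case: (odd _) => ry oy rx ox; [exists y, x | exists x, y]; split=> //;
  by rewrite ox oy; case: (col v).
Qed.

Lemma skeleton_value u v b : adj (skeleton T) u v -> exists x, reachT u v b x.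
Proof.
by move/skeleton_values => [x [y [rx ry _]]]; case: b; [exists y | exists x].
Qed.

(** Some value at [u] exists for [b], and non-colourability forces every value at [v] to equal
    it. *)
Lemma skeleton_value_unique u v b x y : adj (skeleton T) u v ->
  reachT u v b x -> reachT u v b y -> x = y.
Proof.
move=> sk rx ry; have vu : adj (skeleton T) v u by rewrite adj_sym.
have [z rz] := skeleton_value b vu; have uv := skeleton_adj_tree sk.
by rewrite (edge_value uv rx rz) (edge_value uv ry rz).
Qed.

Let N v := [set c | adj (skeleton T) v c].
Let ld v := load T (K true) (K false) v.
(** [k] counts the skeleton edges of weight 1 at [v]; the nonskeleton ones, weighted by their
    orientation, add [ld v]. *)
Let blocked v b c (k : nat) : bool := `[< forall y, reachT v c b y -> y = (ld v + k)%N%:Z >].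

(** Applies [stuck_structure] to the skeleton neighbours, which have values of opposite parities for
    the two weights. A nonskeleton edge weighted by its orientation never blocks, having two
    values. *)
Lemma skeleton_stuck v :
  [/\ #|N v| = 1%N \/ #|N v| = 3%N,
      forall c, c \in N v -> (blocked v false c 0 /\ blocked v true c #|N v|) \/
        [/\ #|N v| = 3%N, blocked v false c 1 & blocked v true c 2] &
      #|[set c in N v | blocked v true c 3]| = (#|N v| == 3%N)].
Proof.
have inN c : (c \in N v) = adj (skeleton T) v c by rewrite inE.
apply: stuck_structure.
- move=> c k l; rewrite inN => /(skeleton_value false)[x rx] /asboolP bk /asboolP bl.
  by have := bk x rx; have := bl x rx; lia.
- move=> c k l; rewrite inN => /(skeleton_value true)[x rx] /asboolP bk /asboolP bl.
  by have := bk x rx; have := bl x rx; lia.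
- move=> c k l; rewrite inN => /skeleton_values[x [y [rx ry xy]]] /asboolP bk /asboolP bl.
  by move: xy; rewrite (bk x rx) (bl y ry) !absz_nat !oddD; do 3! case: (odd _).
move=> A sA; apply: contrapT => nstuck; apply: nc.
pose h c := if adj (skeleton T) v c then c \in A else dir v c.
have hE : \sum_(c | adj T v c) bit (h c) = (ld v + #|A|)%N%:Z.
  rewrite sum_bit (card_out (X := K true) (Y := K false)).
    congr (_ + _)%N%:Z; apply: eq_card => c; rewrite in_set /h.
    have [//|ns] := boolP (adj (skeleton T) v c).
    by apply/esym/negP => /(subsetP sA); rewrite inN (negbTE ns).
  by move=> c vc ns; rewrite /h (negbTE ns).
apply: (colourable_star treeT (v := v) (h := h)) => c vc; rewrite hE /h.
case: ifPn => [sk|ns].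
  apply: contrapT => nex; apply: nstuck; exists c; first by rewrite inN.
  have blk : forall y, reachT v c (c \in A) y -> y = (ld v + #|A|)%N%:Z.
    by move=> y ry; apply: contrapT => /eqP ny; apply: nex; exists y.
  by case: ifP blk => _ blk; apply/asboolP.
have [x [y [xy rx ry]]] := nonskeleton_two_values vc ns.
have [xE|nx] := eqVneq x (ld v + #|A|)%N%:Z; last by exists x.
by exists y => //; rewrite -xE eq_sym.
Qed.

(** In both patterns of [skeleton_stuck] the two blocked counts add up to the skeleton degree. *)
Lemma skeleton_value_sum u v x y : adj (skeleton T) u v ->
  reachT u v false x -> reachT u v true y ->
  x + y = (adjusted_load T (K true) (K false) u)%:Z.
Proof.
move=> uv rx ry; have [_ blk _] := skeleton_stuck u.
rewrite /adjusted_load degreeE -/(N u) -/(ld u).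
by have [|[/asboolP b0 /asboolP b1]|[-> /asboolP b0 /asboolP b1]] := blk v;
  rewrite ?inE // (b0 x rx) (b1 y ry); lia.
Qed.

(** By [edge_value] the two ends have the same values for each weight, hence the same sum of
    them. *)
Lemma adjusted_load_skeleton u v : adj (skeleton T) u v ->
  adjusted_load T (K true) (K false) u = adjusted_load T (K true) (K false) v.
Proof.
move=> uv; have vu : adj (skeleton T) v u by rewrite adj_sym.
have [x [y [rx ry _]]] := skeleton_values uv; have [x' [y' [rx' ry' _]]] := skeleton_values vu.
have := skeleton_value_sum uv rx ry; have := skeleton_value_sum vu rx' ry'.
have uvT := skeleton_adj_tree uv.
by rewrite (edge_value uvT rx rx') (edge_value uvT ry ry') => ->; lia.
Qed.

(** Matched edges are those whose values for weights 0 and 1 differ by 3, the pattern with counts 0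
    and 3; this is symmetric because both ends have the same values. *)
Lemma skeleton_triple_matching : exists m, triple_matching (skeleton T) m.
Proof.
pose m v c := adj (skeleton T) v c &&
  `[< forall x y, reachT v c false x -> reachT v c true y -> y = x + 3 >].
exists m; split.
- have sym1 u v : m u v -> m v u.
    case/andP=> uv /asboolP m3; rewrite /m adj_sym uv; apply/asboolP => x y rx ry.
    have [x' [y' [rx' ry' _]]] := skeleton_values uv; have uvT := skeleton_adj_tree uv.
    by rewrite -(edge_value uvT rx' rx) -(edge_value uvT ry' ry); apply: m3.
  by move=> u v; apply/idP/idP; apply: sym1.
- by move=> u v /andP[].
- by move=> v; rewrite degreeE; have [] := skeleton_stuck v.
move=> v; rewrite degreeE -/(N v); have [N13 blk <-] := skeleton_stuck v.
apply: eq_card => c; rewrite [LHS]in_set [RHS]in_set /m.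
have -> : (c \in N v) = adj (skeleton T) v c by rewrite in_set.
have [vc|//] := boolP (adj (skeleton T) v c); rewrite /=.
have [x [y [rx ry _]]] := skeleton_values vc.
have yu z : reachT v c true z -> z = y by move=> rz; apply: skeleton_value_unique rz ry.
have xu z : reachT v c false z -> z = x by move=> rz; apply: skeleton_value_unique rz rx.
have [|[/asboolP b0 /asboolP b1]|[N3 /asboolP b0 /asboolP b1]] := blk c; first by rewrite in_set.
  have := b0 x rx; have := b1 y ry => yE xE.
  apply/asboolP/asboolP => [/(_ x y rx ry) E z /yu ->|/(_ y ry) E x' y' /xu -> /yu ->];
    by case: N13 => N13; rewrite N13 in yE; lia.
have := b0 x rx; have := b1 y ry => yE xE.
by apply/asboolP/asboolP => [/(_ x y rx ry) E z /yu ->|/(_ y ry) E x' y' /xu -> /yu ->]; lia.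
Qed.

End UnitWeights.

(** * The characterization for weights 0 and 1 *)

Section UnitWeightsCharacterization.
Variables (V : finType) (T : sgraph V).
Hypothesis treeT : is_tree T.

Lemma skeleton_acyclic : acyclic_graph (skeleton T).
Proof.
apply: (acyclic_sub (f := id) _ _ treeT.2) => // x y; exact: skeleton_adj_tree.
Qed.

Lemma unit_weights : ~ colourable T bit <-> exists X Y : {set V},
  [/\ bipartition T X Y, odd #|X|, odd #|Y| &
      forall S : {set V}, S \in components (skeleton T) ->
        familyC (induced (skeleton T) S) /\
        (forall u v : V, u \in S -> v \in S ->
           adjusted_load T X Y u = adjusted_load T X Y v)].
Proof.
split=> [nc|[X [Y [[XYT XYd _] oddX oddY SP]]]].
  have [col colP] := tree_two_colouring treeT.
  exists [set v | col v == true], [set v | col v == false]; split.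
  - split; [exact: classes_cover | exact: classes_disjoint |].
    by move=> u v uv; rewrite !inE (colP u v uv); case: (col v).
  - exact: (odd_class treeT nc colP).
  - exact: (odd_class treeT nc colP).
  move=> S SJ; split; last first.
    move=> u v uS vS; have uv : connect (adj (skeleton T)) u v.
      by have := mem_componentE SJ uS => SE; move: vS; rewrite SE inE.
    set lam := adjusted_load T _ _.
    have step p q : lam p == lam u -> adj (skeleton T) p q -> lam q == lam u.
      by move=> /eqP <- pq; rewrite /lam (adjusted_load_skeleton treeT nc colP pq).
    have /eqP-> // := connect_propagate (P := fun x => lam x == lam u) step uv (eqxx _).
  apply: (components_triple_matching skeleton_acyclic).2 S SJ.
  exact: (skeleton_triple_matching treeT nc colP).
have [|m mP] := (components_triple_matching skeleton_acyclic).1.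
  by move=> S /SP[].
apply: (triple_skeleton_not_colourable treeT XYT XYd oddX oddY mP) => u v uv.
have [|_] := SP (component (skeleton T) u); first by apply: imset_f.
apply; first by rewrite inE connect0.
by rewrite (component_adj uv) inE connect0.
Qed.

End UnitWeightsCharacterization.

(** * Scaling to integer weights, and the three cases *)

Lemma colourable_scale (R : numDomainType) (V : finType) (T : sgraph V) (a : R)
    (wt : bool -> int) : (a != 0)%R ->
  colourable T (fun t => a *~ wt t)%R <-> colourable T wt.
Proof.
move=> a0; apply: (colourable_morph T wt (f := fun z => a *~ z)%R).
  by move=> x y; rewrite mulrzDr.
exact: mulrIz.
Qed.

Local Open Scope ring_scope.

Theorem theorem1 (R : realType) (a b : R) (V : finType) (T : sgraph V) :
  a != b -> is_tree T ->
  [/\ a * b * (a + b) != 0 ->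
        (~ admits_proper T (pred2 a b) <-> isomorphic T (complete_graph 2)),
      a + b = 0 ->
        (~ admits_proper T (pred2 a b) <-> familyC T)
    & a * b = 0 ->
        (~ admits_proper T (pred2 a b) <->
         exists X Y : {set V},
           [/\ bipartition T X Y, odd #|X|, odd #|Y| &
               forall S : {set V}, S \in components (skeleton T) ->
                 familyC (induced (skeleton T) S) /\
                 (forall u v : V, u \in S -> v \in S ->
                    adjusted_load T X Y u = adjusted_load T X Y v)])].
Proof.
move=> ab treeT; pose wt (t : bool) := if t then a else b.
have reduce (wt' : bool -> int) P : (colourable T wt <-> colourable T wt') ->
    (~ colourable T wt' <-> P) -> ~ admits_proper T (pred2 a b) <-> P.
  by have := admits_proper_colourable T ab; rewrite -/wt; tauto.
split=> [|/eqP|/eqP].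
- rewrite !mulf_eq0 !negb_or => /andP[/andP[a0 b0] sab].
  have E := admits_proper_colourable T ab.
  split=> [nc|iso /E]; last exact: K2_not_colourable.
  have [//|c|[v dv]] := K2_or_branching treeT wt; first by case: nc; apply/E.
  by case: nc; apply/E; apply: (generic_colourable treeT _ ab sab dv) => -[].
- rewrite addr_eq0 => /eqP aE.
  have a0 : a != 0 by apply: contraNneq ab => a0; rewrite -[b]opprK -aE a0 oppr0.
  apply: (reduce sgnb); last exact: opposite_weights.
  have -> : wt = fun t => a *~ sgnb t.
    by apply/funext => -[]; rewrite /wt /= ?mulr1z // mulrNz mulr1z aE opprK.
  exact: colourable_scale.
rewrite mulf_eq0 => ab0; apply: (reduce bit); last exact: unit_weights.
have [b0|b0] := eqVneq b 0.
  have a0 : a != 0 by rewrite -b0.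
  have -> : wt = fun t => a *~ bit t.
    by apply/funext => -[]; rewrite /wt /bit /= ?mulr1z ?mulr0z ?b0.
  exact: colourable_scale.
have /eqP a0 : a == 0 by move: ab0; rewrite (negbTE b0) orbF.
(* For [a = 0] the roles of the two values are exchanged, which [colourable_negb] undoes. *)
have wtE : wt = fun t => b *~ (bit \o negb) t.
  by apply/funext => -[]; rewrite /wt /bit /= ?mulr1z ?mulr0z ?a0.
have bitE : (bit \o negb) \o negb = bit by apply/funext => -[].
have scale := colourable_scale T (bit \o negb) b0.
rewrite wtE; split=> [/scale|c]; first exact: colourable_negb.
by apply/scale/colourable_negb; rewrite bitE.
Qed.
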